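(* Let $a\ge 2$ and let $\tau=\tau_1\cdots\tau_{2a}\in S_{2a}$ be the permutation with $\tau_1\tau_3\cdots\tau_{2a-1}=12\cdots a$ and $\tau_2\tau_4\cdots\tau_{2a}=(2a)(2a-1)\cdots(a+1)$; that is, $\tau_{2i-1}=i$ and $\tau_{2i}=2a+1-i$ for $1\le i\le a$. Then $$\mathrm{NM}_\tau(t,x,y)=\left(\frac{1}{U_\tau(t,y)}\right)^x,\qquad U_\tau(t,y)=1+\sum_{n\ge 1}U_{\tau,n}(y)\frac{t^n}{n!},$$ where the polynomials $U_{\tau,n}(y)$ are given by $U_{\tau,1}(y)=-y$ and, for $n\ge 2$, $$\begin{aligned}U_{\tau,n}(y)={}&(1-y)U_{\tau,n-1}(y)-\sum_{k=0}^{\lfloor (n-2a)/(2a)\rfloor}\binom{n-(k+1)a-1}{(k+1)a-1}\,y^{(k+1)a-1}\,U_{\tau,n-2(k+1)a+1}(y)\\&+\sum_{k=0}^{\lfloor (n-2a-2)/(2a)\rfloor}\binom{n-(k+1)a-2}{(k+1)a}\,y^{(k+1)a}\,U_{\tau,n-2(k+1)a-1}(y),\end{aligned}$$ where a sum with negative upper limit is empty.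
   Context: $S_n$ is the set of permutations $\sigma=\sigma_1\cdots\sigma_n$ of $\{1,\dots,n\}$, written in one-line notation. $\mathrm{des}(\sigma)=|\{i:\sigma_i>\sigma_{i+1}\}|$. An entry $\sigma_j$ is a left-to-right minimum of $\sigma$ if $\sigma_i>\sigma_j$ for all $i<j$; $\mathrm{LRmin}(\sigma)$ is the number of left-to-right minima of $\sigma$. For a sequence of distinct positive integers $a_1\cdots a_m$, its reduction $\mathrm{red}(a_1\cdots a_m)\in S_m$ is obtained by replacing the $i$-th smallest entry by $i$. For a permutation $\tau$, $\sigma$ has a $\tau$-match starting at position $i$ if $\mathrm{red}(\sigma_i\sigma_{i+1}\cdots\sigma_j)=\tau$ for some $j>i$ (a match occupies consecutive positions). $\mathcal{NM}_n(\tau)$ is the set of $\sigma\in S_n$ with no $\tau$-match. Define $$\mathrm{NM}_\tau(t,x,y)=\sum_{n\ge 0}\frac{t^n}{n!}\mathrm{NM}_{\tau,n}(x,y),\qquad \mathrm{NM}_{\tau,n}(x,y)=\sum_{\sigma\in\mathcal{NM}_n(\tau)}x^{\mathrm{LRmin}(\sigma)}y^{1+\mathrm{des}(\sigma)}\ (n\ge1),$$ with the $n=0$ term equal to $1$. All identities are between formal power series in $t$, and for a power series $F$ in $t$ with constant term $1$, $F^x=\exp(x\log F)$. *)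

(* Defs.v *)
From mathcomp Require Import all_boot all_order all_fingroup all_algebra.
From mathcomp Require Import zify.

Set Implicit Arguments.
Unset Strict Implicit.
Unset Printing Implicit Defensive.

Import GRing.Theory.

(** * Permutations in one-line notation

    [S_n] is ['S_n], whose elements permute {0, .., n-1}; the positions and
    values of [oneline] and [letter] are shifted to {1, .., n}. *)

Definition oneline n (s : 'S_n) : seq nat :=
  [seq (s i : nat).+1 | i <- enum 'I_n].

(* The i-th letter, with i in {1, .., n}. *)
Definition letter n (s : 'S_n) (i : nat) : nat := nth 0 (oneline s) i.-1.

Definition des n (s : 'S_n) : nat :=
  #|[set i : 'I_n | [exists j : 'I_n, (j == i.+1 :> nat) && (s j < s i)]]|.

Definition LRmin n (s : 'S_n) : nat :=
  #|[set j : 'I_n | [forall i : 'I_n, (i < j) ==> (s j < s i)]]|.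

(* In a sequence of distinct numbers, the i-th smallest entry is the one with
   i - 1 smaller entries. *)
Definition red (w : seq nat) : seq nat :=
  [seq (count (fun y => y < x) w).+1 | x <- w].

(* [slice w i j] is w_i w_(i+1) .. w_j, with 0-based positions. *)
Definition slice (w : seq nat) (i j : nat) : seq nat :=
  take (j - i).+1 (drop i w).

Definition has_match_at m (tau : 'S_m) n (s : 'S_n) (i : 'I_n) : bool :=
  [exists j : 'I_n, (i < j) && (red (slice (oneline s) i j) == oneline tau)].

Definition NMset m (tau : 'S_m) n : {set 'S_n} :=
  [set s : 'S_n | [forall i : 'I_n, ~~ has_match_at tau s i]].

Local Open Scope ring_scope.

(** * Formal power series in t

    A series is its coefficient sequence.  The coefficient ring [R] is meant to
    contain the rationals, so that [k%:R^-1] is the inverse of k > 0. *)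

Section FormalPowerSeries.

Variable R : comUnitRingType.
Implicit Types (F G c : nat -> R) (n k : nat).

Definition fps_one : nat -> R := fun n => (n == 0%N)%:R.

Definition fps_mul F G : nat -> R := fun n => \sum_(i < n.+1) F i * G (n - i)%N.

Definition fps_exp F k : nat -> R := iter k (fps_mul F) fps_one.

(* The series sum_(k >= 0) c_k G^k, for G with constant term 0: the terms with
   k > n do not contribute to the coefficient of t^n. *)
Definition fps_comp c G : nat -> R :=
  fun n => \sum_(k < n.+1) c k * fps_exp G k n.

(* exp G, for G with constant term 0. *)
Definition fps_Exp G : nat -> R := fps_comp (fun k => (k`!)%:R^-1) G.

(* log F = sum_(k >= 1) (-1)^(k-1) / k (F - 1)^k, for F with constant
   term 1. *)
Definition fps_Log F : nat -> R :=
  fps_comp (fun k => if k is k'.+1 then (-1) ^+ k' / k%:R else 0)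
           (fun n => F n - fps_one n).

(* F^x = exp (x log F), for F with constant term 1. *)
Definition fps_pow F (x : R) : nat -> R := fps_Exp (fun n => x * fps_Log F n).

(* 1 / F = sum_(k >= 0) (1 - F)^k, for F with constant term 1. *)
Definition fps_inv F : nat -> R :=
  fps_comp (fun _ => 1) (fun n => fps_one n - F n).

(* The series sum_(n >= 0) c_n t^n / n! *)
Definition egf c : nat -> R := fun n => c n * (n`!)%:R^-1.

Lemma fps_exp_small G k n : G 0%N = 0 -> (n < k)%N -> fps_exp G k n = 0.
Proof.
move=> G0; elim: k n => // k IHk n ltnk; rewrite /fps_exp iterS.
apply: big1 => i _; case: (posnP i) => [-> | i_gt0]; first by rewrite G0 mul0r.
by rewrite [X in _ * X]IHk ?mulr0 //; have := ltn_ord i; lia.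
Qed.

Lemma fps_mul_inv F : F 0%N = 1 -> fps_mul F (fps_inv F) =1 fps_one.
Proof.
move=> F0 n; set G := fun n => fps_one n - F n.
have G0 : G 0%N = 0 by rewrite /G F0 subrr.
have invE i : (i < n.+1)%N ->
    fps_inv F (n - i)%N = \sum_(k < n.+1) fps_exp G k (n - i)%N.
  move=> lein; have le: ((n - i).+1 <= n.+1)%N by lia.
  rewrite /fps_inv /fps_comp -/G (big_ord_widen _ (fun k => 1 * fps_exp G k _) le).
  rewrite big_mkcond; apply: eq_bigr => k _; rewrite mul1r.
  by case: ifPn => // nlt; rewrite fps_exp_small //; lia.
rewrite /fps_mul (eq_bigr (fun i : 'I_n.+1 =>
  \sum_(k < n.+1) F i * fps_exp G k (n - i)%N)); last first.
  by move=> i _; rewrite invE // mulr_sumr.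
rewrite exchange_big /=.
rewrite (eq_bigr (fun k : 'I_n.+1 => fps_exp G k n - fps_exp G k.+1 n)).
  rewrite -(big_mkord xpredT (fun k => fps_exp G k n - fps_exp G k.+1 n)).
  rewrite (eq_bigr (fun k => - (fps_exp G k.+1 n - fps_exp G k n))).
    by rewrite sumrN telescope_sumr // (fps_exp_small G0) // sub0r opprK.
  by move=> k _; rewrite opprB.
move=> k _; have ->: fps_exp G k.+1 n = fps_mul G (fps_exp G k) n by [].
rewrite /fps_mul.
rewrite (eq_bigr (fun i : 'I_n.+1 => fps_one i * fps_exp G k (n - i)%N
  - G i * fps_exp G k (n - i)%N)) => [|i _]; last first.
  by rewrite -mulrBl /G opprB addrC subrK.
rewrite sumrB big_ord_recl subn0 mul1r big1 ?addr0 // => i _.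
by rewrite /fps_one /= mul0r.
Qed.

End FormalPowerSeries.

(** * The generating function

    The coefficient ring is Q[y][x]: the variable x is ['X : {poly {poly rat}}]
    and y is ['X : {poly rat}], embedded in {poly {poly rat}} as ['X%:P]. *)

Definition NMpoly m (tau : 'S_m) (n : nat) : {poly {poly rat}} :=
  if n == 0%N then 1
  else \sum_(s in NMset tau n) 'X^(LRmin s) * ('X^(1 + des s))%:P.

Definition NM m (tau : 'S_m) : nat -> {poly {poly rat}} := egf (NMpoly tau).

(* U_0 = 1 is the constant term of U.  For n >= 1 the number of integers k with
   0 <= k <= floor ((n - 2a) / (2a)) is n %/ (2 * a), and for n >= 2 the
   number with 0 <= k <= floor ((n - 2a - 2) / (2a)) is (n - 2) %/ (2 * a); for
   these k, every subtraction below is that of the integers. *)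
Definition U_recurrence (a : nat) (U : nat -> {poly rat}) : Prop :=
  [/\ U 0%N = 1,
      U 1%N = - 'X
    & forall n : nat, (2 <= n)%N ->
      U n = (1 - 'X) * U (n - 1)%N
          - \sum_(0 <= k < n %/ (2 * a))
              ('C(n - (k + 1) * a - 1, (k + 1) * a - 1))%:R
                * 'X^((k + 1) * a - 1) * U (n - 2 * (k + 1) * a + 1)%N
          + \sum_(0 <= k < (n - 2) %/ (2 * a))
              ('C(n - (k + 1) * a - 2, (k + 1) * a))%:R
                * 'X^((k + 1) * a) * U (n - 2 * (k + 1) * a - 1)%N].

(* Main.v *)
Require Import Defs.
From mathcomp Require Import all_boot all_order all_fingroup all_algebra.
From mathcomp Require Import zify ring.

(** A zigzag with m pairs is a word l_1 h_1 l_2 h_2 .. l_m h_m with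
    l_1 < .. < l_m < h_m < .. < h_1, so that the pattern is the zigzag with a
    pairs.  Two overlapping occurrences of it share either an even number of
    letters, and then they form a longer zigzag, or exactly one letter.

    The proof is the cluster method of Goulden and Jackson.  Give a nonempty
    word w the weight y^(1 + des w) if it has no match and 0 otherwise.  Write
    the factor of two neighbours as y + (1 - y) for an ascent and y for a
    descent, with one more factor y for the first letter, and expand the absence
    of matches by inclusion-exclusion.  Then
    neighbours are either free, with factor y, or linked, by an ascent with
    factor 1 - y or inside a zigzag that is covered by overlapping marked
    matches.  Splitting off the first maximal linked factor gives
      weight w = sum over w = u v of link u * weight v,
    where link u is the signed sum over all ways to link u ([weight_link]).

    The signed number of covers of a zigzag with m pairs is the coefficient of
    z^m in - z^a / (1 + z + .. + z^(a-1)) = - (1 - z) (z^a + z^(2a) + ..).  It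
    is -1 if a divides m and 1 if a divides m - 1, with m >= a; this is where
    the two sums in the recurrence come from.

    A linked word begins with its least letter.  If its first link is a zigzag
    with m pairs, then the lows are the m least letters, the last high is the
    next one, and the other m - 1 highs are any of the n - m - 1 remaining
    letters.  This is the recurrence for U, so the words on n letters have
    total link - U_n ([wsum_link]).  Hence P = NM(t, 1, y) satisfies U P = 1
    ([wsum_weight]).

    The variable x enters through the least letter.  The pattern begins with
    its least letter, so no match contains both the least letter of a
    permutation and a letter before it.  Cutting the permutation before its
    least letter, which is the last left-to-right minimum, gives N' = x N B for
    N = NM(t, x, y), where B does not depend on x ([wsum_lr_weight]).  At x = 1
    this says B = (log P)', and therefore N = P^x = (1 / U)^x. *)

Set Implicit Arguments.
Unset Strict Implicit.
Unset Printing Implicit Defensive.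

Import GRing.Theory.
Local Open Scope ring_scope.

(** * Formal power series *)

Section Fps.
Variable R : comUnitRingType.
Implicit Types (F G H c : nat -> R) (n k : nat).

Definition fps_D F : nat -> R := fun n => F n.+1 *+ n.+1.

Lemma eq_fps_mul F F' G G' :
  F =1 F' -> G =1 G' -> fps_mul F G =1 fps_mul F' G'.
Proof. by move=> eF eG n; apply: eq_bigr => i _; rewrite eF eG. Qed.

Lemma fps_mulC F G : fps_mul F G =1 fps_mul G F.
Proof.
move=> n; rewrite /fps_mul (reindex_inj rev_ord_inj) /=.
by apply: eq_bigr => i _; rewrite mulrC subSS subKn // -ltnS.
Qed.

(** Reduces products of series to products of polynomials, from which
    associativity and the Leibniz rule are inherited. *)
Lemma fps_mul_poly F G N n : (n < N)%N ->
  fps_mul F G n = (\poly_(i < N) F i * \poly_(i < N) G i)`_n.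
Proof.
move=> ltnN; rewrite coefM; apply: eq_bigr => i _.
by rewrite !coef_poly !ifT //; have := ltn_ord i; lia.
Qed.

Lemma fps_mulA F G H : fps_mul F (fps_mul G H) =1 fps_mul (fps_mul F G) H.
Proof.
move=> n; pose P K := \poly_(i < n.+1) (K i : R).
have coefP K i : (i < n.+1)%N -> (P K)`_i = K i.
  by move=> lt; rewrite coef_poly lt.
transitivity ((P F * (P G * P H))`_n); last rewrite mulrA.
  rewrite coefM; apply: eq_bigr => i _; rewrite coefP //; congr (_ * _).
  by apply: fps_mul_poly; lia.
rewrite coefM; apply: eq_bigr => i _; rewrite [X in _ * X]coefP; last by lia.
by congr (_ * _); rewrite (@fps_mul_poly _ _ n.+1).
Qed.

Lemma fps_mul1 F : fps_mul (@fps_one R) F =1 F.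
Proof.
move=> n; rewrite /fps_mul big_ord_recl subn0 /fps_one mul1r big1 ?addr0 //.
by move=> i _; rewrite mul0r.
Qed.

Lemma fps_D_mul F G n :
  fps_D (fps_mul F G) n = fps_mul (fps_D F) G n + fps_mul F (fps_D G) n.
Proof.
pose P K := \poly_(i < n.+2) (K i : R).
rewrite /fps_D (@fps_mul_poly F G n.+2) // -coef_deriv derivM coefD !coefM.
by congr (_ + _); apply: eq_bigr => i _; rewrite coef_deriv !coef_poly !ifT //;
  have := ltn_ord i; lia.
Qed.

Lemma fps_D_exp G k n :
  fps_D (fps_exp G k.+1) n = fps_mul (fps_exp G k) (fps_D G) n *+ k.+1.
Proof.
elim: k n => [|k IHk] n.
  rewrite mulr1n fps_mul1 /fps_D; congr (_ *+ _).
  by rewrite /fps_exp /= fps_mulC fps_mul1.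
have -> : fps_D (fps_exp G k.+2) n = fps_D (fps_mul G (fps_exp G k.+1)) n by [].
rewrite fps_D_mul fps_mulC mulrSr addrC; congr (_ + _).
rewrite (eq_fps_mul (frefl G) IHk).
have -> : fps_mul (fps_exp G k.+1) (fps_D G) n
          = fps_mul G (fps_mul (fps_exp G k) (fps_D G)) n by rewrite fps_mulA.
by rewrite /fps_mul -sumrMnl; apply: eq_bigr => i _; rewrite mulrnAr.
Qed.

(** The chain rule, with the outer derivative given by its coefficients. *)
Lemma fps_D_comp c G : G 0%N = 0 ->
  fps_D (fps_comp c G) =1
  fps_mul (fps_comp (fun k => c k.+1 *+ k.+1) G) (fps_D G).
Proof.
move=> G0 n; rewrite /fps_D /fps_comp big_ord_recl mulrnDl.
have -> : fps_exp G (@ord0 n.+1) n.+1 = 0 by [].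
rewrite mulr0 mul0rn add0r -sumrMnl.
transitivity (\sum_(k < n.+1) \sum_(i < n.+1)
   c k.+1 *+ k.+1 * fps_exp G k i * fps_D G (n - i)%N).
  apply: eq_bigr => k _; rewrite -mulrnAr -[_ *+ n.+1]/(fps_D _ n).
  rewrite fps_D_exp /fps_mul mulrnAr -mulrnAl mulr_sumr.
  by apply: eq_bigr => i _; rewrite mulrA.
rewrite exchange_big; apply: eq_bigr => i _ /=; rewrite mulr_suml.
have le : (i.+1 <= n.+1)%N by [].
rewrite (big_ord_widen _
  (fun k => c k.+1 *+ k.+1 * fps_exp G k i * fps_D G (n - i)%N) le).
rewrite [RHS]big_mkcond; apply: eq_bigr => k _ /=.
by case: ifPn => // ?; rewrite fps_exp_small ?mulr0 ?mul0r //; lia.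
Qed.

(** Invertibility of the positive integers makes the coefficients of exp and log
    meaningful. *)
Hypothesis natU : forall k, (k.+1%:R : R) \is a GRing.unit.

Lemma fps_D_Exp G : G 0%N = 0 ->
  fps_D (fps_Exp G) =1 fps_mul (fps_Exp G) (fps_D G).
Proof.
move=> G0 n; rewrite fps_D_comp //; apply: eq_fps_mul => // i.
apply: eq_bigr => k _; congr (_ * _).
have fU : ((k : nat)`!%:R : R) \is a GRing.unit.
  by case: (k`!) (fact_gt0 k).
rewrite factS natrM invrM // -mulrnAr -[_^-1 *+ _]mulr_natl divrr //.
by rewrite mulr1.
Qed.

(** The derivative of log is the geometric series sum_k (1 - F)^k. *)
Lemma fps_D_Log F : F 0%N = 1 ->
  fps_D (fps_Log F) =1 fps_mul (fps_inv F) (fps_D F).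
Proof.
move=> F0 n; rewrite /fps_Log fps_D_comp /fps_one ?F0 ?subrr //.
have expN G k i : fps_exp (fun n => - G n) k i = (-1) ^+ k * fps_exp G k i.
  elim: k i => [|k IHk] i; first by rewrite mul1r.
  rewrite -[LHS]/(fps_mul (fun n => - G n) (fps_exp (fun n => - G n) k) i).
  rewrite (eq_fps_mul (frefl _) IHk) -[fps_exp G _ _]/(fps_mul _ _ _).
  rewrite /fps_mul mulr_sumr; apply: eq_bigr => j _.
  by rewrite exprS mulN1r !mulNr; congr (- _); apply: mulrCA.
apply: eq_fps_mul => i; last by rewrite /fps_D subr0.
apply: eq_bigr => k _; rewrite -[_ / _ *+ _]mulr_natr divrK // mul1r -expN.
suff eqG G G' : G =1 G' -> fps_exp G k =1 fps_exp G' k.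
  by apply: eqG => j; rewrite opprB.
by move=> e; elim: (k : nat) => // l IHl; apply: eq_fps_mul.
Qed.

Lemma fps_inv0 F : fps_inv F 0%N = 1.
Proof. by rewrite /fps_inv /fps_comp big_ord1 mul1r. Qed.

Lemma fps_Log0 F : fps_Log F 0%N = 0.
Proof. by rewrite /fps_Log /fps_comp big_ord1 mul0r. Qed.

Lemma fps_Exp0 F : fps_Exp F 0%N = 1.
Proof. by rewrite /fps_Exp /fps_comp big_ord1 /= fact0 invr1 mul1r. Qed.

Lemma fps_D_Log_mul F : F 0%N = 1 ->
  fps_mul F (fps_D (fps_Log F)) =1 fps_D F.
Proof.
move=> F0 n; rewrite (eq_fps_mul (frefl F) (fps_D_Log F0)) fps_mulA.
by rewrite (eq_fps_mul (fps_mul_inv F0) (frefl _)) fps_mul1.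
Qed.

Lemma fps_D_pow F x :
  fps_D (fps_pow F x) =1
  fun n => x * fps_mul (fps_pow F x) (fps_D (fps_Log F)) n.
Proof.
move=> n; rewrite fps_D_Exp ?fps_Log0 ?mulr0 // /fps_mul mulr_sumr.
by apply: eq_bigr => i _; rewrite /fps_D -mulrnAr mulrCA.
Qed.

(** A product of exponential generating functions is the binomial convolution of
    their numerators n! F_n. *)
Lemma fact_fps_mul F G n :
  fps_mul F G n * n`!%:R =
  \sum_(k < n.+1) 'C(n, k)%:R * (F k * k`!%:R) * (G (n - k)%N * (n - k)`!%:R).
Proof.
rewrite /fps_mul mulr_suml; apply: eq_bigr => k _.
rewrite -(@bin_fact n k) ?natrM; last by rewrite -ltnS.
ring.
Qed.

End Fps.

(** * Zigzags, matches and descents in words *)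

Section Words.
Local Open Scope nat_scope.
Implicit Types (w u v : seq nat) (a m i j k : nat).

(** Only the comparisons inside a pair and between neighbouring pairs are
    listed, so that zigzags can be extended and cut; the others follow by
    [zigzag_ltn]. *)
Definition zigzag m w : bool :=
  [&& m.*2 <= size w,
      all (fun i => nth 0 w i.*2 < nth 0 w i.*2.+1) (iota 0 m)
    & all (fun i => (nth 0 w i.*2 < nth 0 w i.*2.+2)
                    && (nth 0 w i.*2.+3 < nth 0 w i.*2.+1)) (iota 0 m.-1)].

Lemma zigzagP m w :
  reflect [/\ m.*2 <= size w,
              forall i, i < m -> nth 0 w i.*2 < nth 0 w i.*2.+1
            & forall i, i.+1 < m -> nth 0 w i.*2 < nth 0 w i.*2.+2 /\
                                    nth 0 w i.*2.+3 < nth 0 w i.*2.+1]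
          (zigzag m w).
Proof.
apply: (iffP and3P) => -[sz /= h1 h2]; split=> //.
- by move=> i ltim; apply: (allP h1); rewrite mem_iota.
- by move=> i ltim; apply/andP/(allP h2); rewrite mem_iota; lia.
- by apply/allP=> i; rewrite mem_iota => lti; apply: h1.
- by apply/allP=> i; rewrite mem_iota => lti; apply/andP/h2; lia.
Qed.

Lemma zigzag0 w : zigzag 0 w. Proof. by []. Qed.

Lemma zigzag1 x z w : zigzag 1 (x :: z :: w) = (x < z).
Proof. by rewrite /zigzag /= !andbT. Qed.

Lemma zigzag_size m w : zigzag m w -> m.*2 <= size w.
Proof. by case/zigzagP. Qed.

Lemma zigzag_le m m' w : m <= m' -> zigzag m' w -> zigzag m w.
Proof.
move=> le /zigzagP[sz h1 h2]; apply/zigzagP; split=> [|i lt|i lt]; first lia.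
  by apply: h1; lia.
by apply: h2; lia.
Qed.

Lemma zigzag_take m k w : m.*2 <= k -> zigzag m (take k w) = zigzag m w.
Proof.
move=> le; have e i : i < m.*2 -> nth 0 (take k w) i = nth 0 w i.
  by move=> lt; rewrite nth_take //; lia.
apply/zigzagP/zigzagP; rewrite size_take_min leq_min le => -[sz h1 h2].
  split=> // i lt; first by move: (h1 _ lt); rewrite !e; lia.
  by move: (h2 _ lt); rewrite !e; lia.
split=> // i lt; first by move: (h1 _ lt); rewrite !e; lia.
by move: (h2 _ lt); rewrite !e; lia.
Qed.

(** Zigzags that share a pair merge, because every condition concerns one pair
    or two neighbouring pairs. *)
Lemma zigzag_cat m a w : 0 < a -> zigzag m.+1 w ->
  zigzag (m + a) w = zigzag a (drop m.*2 w).
Proof.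
move=> a0 /zigzagP[sz g1 g2]; apply/zigzagP/zigzagP;
  rewrite size_drop => -[sza h1 h2].
  split=> [|i lt|i lt]; first lia.
    by rewrite !nth_drop addnS -doubleD; apply: h1; lia.
  by rewrite !nth_drop !addnS -doubleD; apply: h2; lia.
have sub i : m <= i -> i = m + (i - m) by lia.
split=> [|i lt|i lt]; first lia.
  have [ltm|/sub ->] := ltnP i m; first by apply: g1; lia.
  by have := h1 (i - m); rewrite !nth_drop addnS -doubleD; apply; lia.
have [ltm|lem] := ltnP i m; first by apply: g2; lia.
rewrite (sub i lem).
by have := h2 (i - m); rewrite !nth_drop !addnS -doubleD; apply; lia.
Qed.

(** A zigzag begins with an ascent, while a high is followed by a lower low. *)
Lemma zigzag_high m a w i : 0 < a -> zigzag m w -> i.+1 < m ->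
  ~~ zigzag a (drop i.*2.+1 w).
Proof.
move=> a0 /zigzagP[_ h1 h2] lt; apply/negP => /zigzagP[_ g1 _].
move: (g1 0 a0) (h1 _ lt) (h2 _ lt); rewrite !nth_drop !addnS !addn0 /=.
rewrite doubleS; lia.
Qed.

(** The rank of the letter at position i of a zigzag with m pairs: the lows are
    the m least letters, in order, and the highs the m greatest ones, in reverse
    order. *)
Definition zigzag_rank m i : nat := if odd i then m.*2 - i./2.+1 else i./2.

Lemma zigzag_lows m w i j : zigzag m w -> i < j < m ->
  nth 0 w i.*2 < nth 0 w j.*2 /\ nth 0 w j.*2.+1 < nth 0 w i.*2.+1.
Proof.
case/zigzagP=> _ _ h2 /andP[]; elim: j => // j IHj; rewrite ltnS leq_eqVlt.
case/predU1P=> [-> | ltij] ltjm; first by have [] := h2 j ltjm.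
have [lo hi] := IHj ltij (ltnW ltjm); have [] := h2 j ltjm.
by rewrite doubleS; lia.
Qed.

Lemma zigzag_low_high m w i j : zigzag m w -> i < m -> j < m ->
  nth 0 w i.*2 < nth 0 w j.*2.+1.
Proof.
move=> zw ltim ltjm; have [_ h1 _] := zigzagP _ _ zw.
have [ltij|ltji|<-] := ltngtP i j; last exact: h1.
  by have [|lo _] := zigzag_lows zw (_ : i < j < m); [rewrite ltij|];
    have := h1 j ltjm; lia.
by have [|_ hi] := zigzag_lows zw (_ : j < i < m); [rewrite ltji|];
  have := h1 i ltim; lia.
Qed.

Lemma zigzag_ltn m w p q : zigzag m w -> p < m.*2 -> q < m.*2 ->
  (nth 0 w p < nth 0 w q) = (zigzag_rank m p < zigzag_rank m q).
Proof.
move=> zw; rewrite /zigzag_rank -(odd_double_half p) -(odd_double_half q).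
move: p./2 q./2 => i j; case: (odd p); case: (odd q);
  rewrite ?add0n ?add1n /= ?odd_double /= ?uphalf_double ?doubleK => lti ltj.
- have [lt|lt|->] := ltngtP i j; last by rewrite !ltnn.
    have [|_ hi] := zigzag_lows zw (_ : i < j < m); lia.
  have [|_ hi] := zigzag_lows zw (_ : j < i < m); lia.
- have := zigzag_low_high zw (_ : j < m) (_ : i < m); lia.
- have := zigzag_low_high zw (_ : i < m) (_ : j < m); lia.
have [lt|lt|->] := ltngtP i j; last by rewrite !ltnn.
  have [|lo _] := zigzag_lows zw (_ : i < j < m); lia.
have [|lo _] := zigzag_lows zw (_ : j < i < m); lia.
Qed.

Fixpoint avoids a w : bool :=
  if w is _ :: w' then ~~ zigzag a w && avoids a w' else true.

Lemma avoids_drop a w i : i < size w ->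
  avoids a (drop i w) = ~~ zigzag a (drop i w) && avoids a (drop i.+1 w).
Proof. by move=> lt; rewrite (drop_nth 0 lt). Qed.

Lemma avoidsP a w :
  reflect (forall i, i < size w -> ~~ zigzag a (drop i w)) (avoids a w).
Proof.
elim: w => [|x w IHw]; first by constructor.
apply: (iffP andP) => [[zw /IHw aw] [|i] // lt | aw]; first exact: aw.
split; first exact: (aw 0).
by apply/IHw => i lt; apply: (aw i.+1).
Qed.

(** Equal neighbours count as descents.  Words of distinct letters have none,
    and with this convention the identities below hold for all words. *)
Fixpoint wdes w : nat :=
  if w is x :: w' then
    (if w' is z :: _ then ~~ (x < z) : nat else 0) + wdes w'
  else 0.

Lemma wdes_drop w i : i.+1 < size w ->
  wdes (drop i w) = ~~ (nth 0 w i < nth 0 w i.+1) + wdes (drop i.+1 w).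
Proof.
by move=> lt; rewrite (drop_nth 0 (ltnW lt)) (drop_nth 0 lt).
Qed.

Lemma wdes_zigzag m w : zigzag m.+1 w -> wdes w = m + wdes (drop m.*2.+1 w).
Proof.
elim: m => [|m IHm] zw; have [sz h1 h2] := zigzagP _ _ zw.
  by rewrite -[w in LHS]drop0 wdes_drop ?(h1 0) //; lia.
rewrite (IHm (zigzag_le _ zw)) //.
have := h2 m; have := h1 m.+1; rewrite !doubleS => g1 g2.
rewrite wdes_drop; last by move: sz; rewrite !doubleS; lia.
by rewrite wdes_drop; move: sz; rewrite !doubleS; lia.
Qed.

(** The coefficient of z^m in z^a + z^(2a) + .. *)
Definition posmult a m : nat := (0 < m) && (a %| m).

Lemma posmultD a m : 0 < a -> posmult a m = (m == a) + posmult a (m - a).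
Proof.
rewrite /posmult => a0; have [lt|le] := ltnP m a.
  rewrite (_ : m - a = 0) ?ltnn; last by lia.
  rewrite ltn_eqF //=; case: (posnP m) => //= m0.
  by rewrite gtnNdvd.
rewrite subn_gt0 dvdn_subl //; have [->|ne] := eqVneq m a.
  by rewrite dvdnn ltnn; lia.
have lt : a < m by rewrite ltn_neqAle eq_sym ne.
by rewrite lt (leq_trans _ lt) // add0n.
Qed.

Lemma zigzag_max w :
  exists M, M.*2 <= size w /\ forall m, zigzag m w = (m <= M).
Proof.
have ub m : zigzag m w -> m <= size w by move/zigzag_size; lia.
have [M zM maxM] := ex_maxnP (ex_intro (fun m => zigzag m w) 0 (zigzag0 w)) ub.
exists M; split=> [|m]; first exact: zigzag_size.
by apply/idP/idP => [/maxM | /zigzag_le]; last apply.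
Qed.

(** The suffix begins at a high of the maximal initial zigzag, which has M
    pairs.  The matches that begin before the last high of this zigzag must
    begin at a low and stay inside the zigzag, because a match that left it
    would prolong it.  So there is none exactly if fewer than a pairs remain
    after the first high of the suffix. *)
Lemma avoids_inside_zigzag a w M m : 0 < a ->
  (forall k, zigzag k w = (k <= M)) -> m < M ->
  avoids a (drop m.*2.+1 w) = (M <= m + a) && avoids a (drop M.*2.-1 w).
Proof.
move=> a0 hM; move e: (M - m.+1) => d; elim: d m e => [|d IHd] m e lt.
  by rewrite (_ : M = m.+1) 1?doubleS /=; lia.
have zM : zigzag M w by rewrite hM.
have sz := zigzag_size zM.
rewrite avoids_drop; last lia.
rewrite (zigzag_high a0 zM) /=; last lia.
rewrite -doubleS avoids_drop -?zigzag_cat ?hM; try lia.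
by rewrite IHd; lia.
Qed.

End Words.

Section Identity.
Variables (R : comNzRingType) (a : nat) (y : R).
Hypothesis a0 : (0 < a)%N.
Implicit Types (w u v : seq nat) (m k : nat).

(** Inclusion-exclusion for the matches in the initial zigzag of w.  The
    right-hand side is 1 if w has a match at its start and nowhere else, and 0
    otherwise.  If the maximal initial zigzag has M pairs, only terms with
    M - a <= m < M can be nonzero.  When no match begins at or after the last
    high of this zigzag, the sum telescopes to
    posmult M - posmult (M - a) = (M == a), and otherwise it is 0. *)
Lemma avoids_posmult w : (0 < size w)%N ->
  \sum_(m < size w) ((posmult a m.+1)%:R - (posmult a m)%:R)
     * (zigzag m.+1 w && avoids a (drop m.*2.+1 w))%:R
  = (avoids a (behead w))%:R - (avoids a w)%:R :> R.
Proof.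
move=> szw; have [M [szM hM]] := zigzag_max w.
have aw : avoids a w = (M < a)%N && avoids a (behead w).
  by case: w szw hM {szM} => //= x w _ hM; rewrite hM -ltnNge.
have [M0|Mpos] := posnP M.
  rewrite big1 => [|m _]; last by rewrite hM M0 mulr0.
  by rewrite aw M0 a0 subrr.
rewrite aw; have -> : avoids a (behead w) =
    (M <= a)%N && avoids a (drop M.*2.-1 w).
  by rewrite -drop1; apply: (avoids_inside_zigzag (m := 0) a0 hM).
case aE: (avoids a (drop M.*2.-1 w)); last first.
  rewrite !andbF subrr big1 // => m _; rewrite hM.
  case: ltnP => [lt|_]; last by rewrite mulr0.
  by rewrite (avoids_inside_zigzag a0 hM) // aE andbF mulr0.
transitivity (\sum_(0 <= m < size w | (M - a <= m)%N && (m < M)%N)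
                 ((posmult a m.+1)%:R - (posmult a m)%:R : R)).
  rewrite big_mkord [RHS]big_mkcond; apply: eq_bigr => m _; rewrite hM.
  case: ltnP => [lt|_]; last by rewrite andbF mulr0.
  rewrite (avoids_inside_zigzag a0 hM) // aE !andbT.
  have -> : (M - a <= m)%N = (M <= m + a)%N by lia.
  by case: leqP; rewrite ?mulr1 ?mulr0.
rewrite (_ : \sum_(0 <= m < size w | _) _ =
   \sum_(M - a <= m < M) ((posmult a m.+1)%:R - (posmult a m)%:R : R)).
  rewrite telescope_sumr ?leq_subr // (posmultD M a0) natrD addrK.
  by rewrite !andbT; case: ltngtP; rewrite ?subrr ?subr0.
rewrite (@big_cat_nat _ _ _ M 0 (size w)) /=; try lia.
rewrite [X in _ + X]big_nat_cond [X in _ + X]big_pred0 ?addr0;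
  last by move=> m; lia.
rewrite (@big_cat_nat _ _ _ (M - a) 0 M) /=; try lia.
rewrite [X in X + _]big_nat_cond [X in X + _]big_pred0 ?add0r;
  last by move=> m; lia.
by rewrite big_nat_cond [RHS]big_nat_cond; apply: eq_bigl => m; lia.
Qed.

(** The weight of a link by a zigzag with m + 1 pairs, which has m descents.
    The difference of two values of [posmult] is minus the signed number of
    covers of the zigzag by marked matches.  A linked ascent is a zigzag with
    one pair and contributes 1 - y for m = 0. *)
Definition link_coef m : R :=
  (1 - y) * (m == 0%N)%:R - ((posmult a m.+1)%:R - (posmult a m)%:R) * y ^+ m.

(** The signed sum over all ways to link w, by the choice of the first link: a
    zigzag with m + 1 pairs, whose last high begins the rest.  The bound n on
    the size of w makes the recursion on suffixes structural. *)
Fixpoint link_rec (n : nat) w : R :=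
  if n isn't n'.+1 then 0 else
  match w with
  | [::] => 0
  | [:: _] => y
  | _ => \sum_(m < size w) link_coef m * (zigzag m.+1 w)%:R
                            * link_rec n' (drop m.*2.+1 w)
  end.

Definition link w : R := link_rec (size w) w.

Lemma link_recE n w : (size w <= n)%N -> link_rec n w = link w.
Proof.
suff gen k : (size w <= k -> size w <= n -> link_rec n w = link_rec k w)%N.
  exact: gen.
elim: n k w => [|n IHn] [|k] [|x [|z w]] //= lek len.
by apply: eq_bigr => m _; congr (_ * _); apply: IHn; rewrite size_drop /=; lia.
Qed.

Lemma linkE w : (1 < size w)%N ->
  link w =
  \sum_(m < size w) link_coef m * (zigzag m.+1 w)%:R * link (drop m.*2.+1 w).
Proof.
case: w => [|x [|z w]] // _; set v := x :: _.
rewrite -[LHS]/(\sum_(m < size v) link_coef m * (zigzag m.+1 v)%:R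
  * link_rec (size w).+1 (drop m.*2.+1 v)).
apply: eq_bigr => m _; congr (_ * _).
by rewrite link_recE // size_drop /=; lia.
Qed.

Lemma link_take w k : (1 < k <= size w)%N ->
  link (take k w) = \sum_(m < size w) link_coef m * (zigzag m.+1 w)%:R
    * ((m.*2 < k)%N%:R * link (take (k - m.*2.+1) (drop m.*2.+1 w))).
Proof.
case/andP=> k1 lek; have szk : size (take k w) = k by rewrite size_takel.
rewrite linkE szk //.
rewrite (big_ord_widen _ (fun m => link_coef m * (zigzag m.+1 (take k w))%:R
  * link (drop m.*2.+1 (take k w))) lek) big_mkcond.
apply: eq_bigr => m _; have [ltmk|lekm] := ltnP (m.*2.+1) k; last first.
  have -> : (k - m.*2.+1 = 0)%N by lia.
  rewrite take0 !mulr0; case: ifP => // _.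
  case zz: (zigzag _ _); last by rewrite mulr0 mul0r.
  by have := zigzag_size zz; rewrite szk doubleS; lia.
rewrite (ltnW ltmk) mul1r ifT; last lia.
by rewrite zigzag_take ?doubleS // take_drop subnK // ltnW.
Qed.

Definition weight w : R :=
  (avoids a w)%:R * y ^+ ((0 < size w)%N + wdes w).

Lemma weight0 : weight [::] = 1.
Proof. by rewrite /weight mulr1. Qed.

(** The weight with the first letter split off.  The term y * weight (behead w)
    treats the first two letters as free neighbours, the part 1 - y of
    [link_coef 0] corrects it for an ascent, and the rest of the sum removes the
    words whose only match is at the start. *)
Lemma weightE w : (1 < size w)%N ->
  weight w = y * weight (behead w)
    + \sum_(m < size w) link_coef m * (zigzag m.+1 w)%:R
                          * weight (drop m.*2.+1 w).
Proof.
move=> szw; have sz0 : (0 < size w)%N by lia.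
have -> :
  \sum_(m < size w) link_coef m * (zigzag m.+1 w)%:R * weight (drop m.*2.+1 w)
  = (1 - y) * (zigzag 1 w)%:R * weight (behead w)
    - ((avoids a (behead w))%:R - (avoids a w)%:R) * y ^+ (wdes w).+1.
  rewrite -(avoids_posmult sz0) mulr_suml.
  rewrite (eq_bigr (fun m : 'I_(size w) =>
     (1 - y) * (m == 0%N :> nat)%:R * (zigzag m.+1 w)%:R
       * weight (drop m.*2.+1 w)
     - ((posmult a m.+1)%:R - (posmult a m)%:R) *
        (zigzag m.+1 w && avoids a (drop m.*2.+1 w))%:R * y ^+ (wdes w).+1)).
    rewrite sumrB; congr (_ - _).
    rewrite (bigD1 (Ordinal sz0)) //= big1 => [|m ne].
      by rewrite mulr1 addr0 drop1.
    rewrite (_ : (m == 0%N :> nat) = false) ?mulr0 ?mul0r //.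
    by apply: contraNF ne => /eqP m0; apply/eqP/val_inj.
  move=> m _; rewrite /link_coef.
  case zz: (zigzag _ _); last by rewrite /= !mulr0 !mul0r subr0.
  have szm := zigzag_size zz; rewrite /= (wdes_zigzag zz).
  rewrite /weight size_drop subn_gt0 (_ : (m.*2.+1 < size w)%N); last first.
    by move: szm; rewrite doubleS.
  rewrite -addnS [y ^+ (m + _)]exprD add1n; case: (avoids _ _) => /=; ring.
have wd : wdes w = (~~ zigzag 1 w + wdes (behead w))%N.
  by case: w szw {sz0} => [|u [|v w]] // _; rewrite zigzag1.
rewrite {1 2 3}/weight sz0 size_behead (_ : (0 < (size w).-1)%N); last lia.
rewrite wd; case: (zigzag 1 w) => /=; rewrite !add1n ?add0n ?exprS; ring.
Qed.

(** Every word is a first linked factor followed by an arbitrary word.  In the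
    induction, [linkE] splits the first link off every u with at least two
    letters; what remains of u and v is a decomposition of a suffix of w, and
    the terms add up by [weightE]. *)
Lemma weight_link w : (0 < size w)%N ->
  weight w = \sum_(0 <= k < (size w).+1) link (take k w) * weight (drop k w).
Proof.
move: {2}(size w) (leqnn (size w)) => n.
elim: n w => [|n IHn] w lew szw; first lia.
have [sz1|szn1] := eqVneq (size w) 1%N.
  case: w sz1 {lew szw} => [|x [|]] // _; rewrite big_nat_recl // big_nat1 /=.
  have za : zigzag a [:: x] = false.
    by apply/negP => /zigzag_size /=; lia.
  by rewrite weight0 mul0r add0r mulr1 /weight /= za mul1r.
have sz1 : (1 < size w)%N by lia.
rewrite weightE //.
(* A factor u of size k = 1 gives the first term of [weightE].  A longer one has
   a first link; its terms with k = 2 m + 1 vanish, because what remains of u is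
   then empty. *)
transitivity (\sum_(0 <= k < (size w).+1)
  ((k == 1%N)%:R * (y * weight (behead w)) +
  \sum_(m < size w) link_coef m * (zigzag m.+1 w)%:R
    * ((m.*2 < k)%N%:R * (link (take (k - m.*2.+1) (drop m.*2.+1 w))
                       * weight (drop k w))))); last first.
  apply: eq_big_nat => k; rewrite ltnS => /andP[_ lek].
  have [k1|] := ltnP 1 k.
    rewrite link_take ?k1 // mulr_suml (gtn_eqF k1) mul0r add0r.
    by apply: eq_bigr => m _; rewrite !mulrA.
  case: k lek => [|[|//]] lek _.
    by rewrite take0 !mul0r add0r big1 // => m _; rewrite mul0r mulr0.
  rewrite mul1r drop1 big1 ?addr0 => [|m _]; last first.
    by rewrite subSS sub0n take0 mul0r !mulr0.
  by case: w szw {lew szn1 sz1 lek IHn} => //= x w _; rewrite take0.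
rewrite big_split /= -mulr_suml -[X in X + _]mul1r; congr (_ * _ + _).
  rewrite (big_cat_nat (n := 2)) //= !big_nat_recl // big_nil /= !addr0 add0r.
  by rewrite big_nat_cond big1 ?addr0 // => k; case: k => [|[|]].
rewrite exchange_big /=; apply: eq_bigr => m _; rewrite -mulr_sumr.
case zz: (zigzag _ _); last by rewrite mulr0 !mul0r.
congr (_ * _); have szm := zigzag_size zz; rewrite doubleS in szm.
rewrite IHn ?size_drop; try lia.
rewrite (@big_cat_nat _ _ _ m.*2.+1 0 (size w).+1) /=; try lia.
rewrite [X in _ = X + _]big_nat_cond [X in _ = X + _]big1 ?add0r; last first.
  by move=> k /andP[/andP[_ lt] _]; rewrite ltnNge -ltnS lt mul0r.
rewrite -[X in _ = \sum_(X <= _ < _) _]add0n [RHS]big_addn subSn; last lia.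
apply: eq_big_nat => k _; rewrite addnK drop_drop.
by rewrite (_ : (_ < k + _)%N) ?mul1r //; lia.
Qed.

End Identity.

(** * Sums over the words on a finite set *)

Section WordSums.
Variables (R : comNzRingType) (N : nat).
Implicit Types (A B C : {set 'I_N}) (f g : seq nat -> R) (w : seq nat).

(** Letters are positive, so the default value 0 of [head] and [nth] is never a
    letter of a word. *)
Definition letters (w : seq 'I_N) : seq nat := [seq (nat_of_ord i).+1 | i <- w].

Definition wsum A f : R := \sum_(w <- permutations (enum A)) f (letters w).

Lemma eq_wsum A f g :
  (forall w, perm_eq w (letters (enum A)) -> f w = g w) -> wsum A f = wsum A g.
Proof.
move=> e; apply: eq_big_seq => w; rewrite mem_permutations => pw.
by apply: e; apply: perm_map.
Qed.

Lemma wsum_eq0 A f : (forall w, perm_eq w (letters (enum A)) -> f w = 0) ->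
  wsum A f = 0.
Proof. by move/eq_wsum->; rewrite /wsum big1. Qed.

Lemma size_word A w : perm_eq w (letters (enum A)) -> size w = #|A|.
Proof. by move/perm_size->; rewrite size_map -cardE. Qed.

Lemma mem_word A w : perm_eq w (letters (enum A)) ->
  forall i : 'I_N, (i.+1 \in w) = (i \in A).
Proof.
move=> pw i; rewrite (perm_mem pw) mem_map ?mem_enum // => j k [/val_inj //].
Qed.

Lemma wordP A w x : perm_eq w (letters (enum A)) -> x \in w ->
  exists2 i : 'I_N, i \in A & x = i.+1.
Proof.
by move=> pw; rewrite (perm_mem pw) => /mapP[i]; rewrite mem_enum; exists i.
Qed.

Lemma wsum_scale A c f : wsum A (fun w => c * f w) = c * wsum A f.
Proof. by rewrite /wsum mulr_sumr. Qed.

Lemma wsum_set0 f : wsum set0 f = f [::].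
Proof. by rewrite /wsum enum_set0 big_seq1. Qed.

Lemma wsum_sum A (I : Type) (r : seq I) (P : pred I) (F : I -> seq nat -> R) :
  wsum A (fun w => \sum_(i <- r | P i) F i w)
  = \sum_(i <- r | P i) wsum A (F i).
Proof. by rewrite /wsum exchange_big. Qed.

Lemma wsum_cons A f : A != set0 ->
  wsum A f = \sum_(b in A) wsum (A :\ b) (fun w => f (b.+1 :: w)).
Proof.
move=> A0; have s0 : (0 < size (enum A))%N by rewrite -cardE card_gt0.
rewrite /wsum (perm_big _ (permutationsE s0)) /=.
rewrite undup_id ?enum_uniq // big_allpairs_dep /= big_enum /=.
apply: eq_bigr => b bA; apply: perm_big; apply: perm_permutations.
apply: uniq_perm; rewrite ?rem_uniq ?enum_uniq // => i.
by rewrite mem_rem_uniq ?enum_uniq // !inE !mem_enum !inE.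
Qed.

(** Cutting a word on A into u and v is choosing the set B of letters of u and
    then ordering B and its complement.  The induction removes the first letter
    of u. *)
Lemma wsum_cut A (h : seq nat -> seq nat -> R) :
  wsum A (fun w => \sum_(0 <= k < (size w).+1) h (take k w) (drop k w))
  = \sum_(B : {set 'I_N} | B \subset A) wsum B (fun u => wsum (A :\: B) (h u)).
Proof.
move: {2}#|A| (erefl #|A|) => n; elim: n A h => [|n IHn] A h cA.
  have -> : A = set0 by apply: cards0_eq.
  rewrite wsum_set0 big_nat1 (big_pred1 set0) => [|B]; last by rewrite subset0.
  by rewrite setD0 !wsum_set0.
have A0 : A != set0 by rewrite -card_gt0 cA.
rewrite [RHS](bigD1 set0) ?sub0set //= wsum_set0 setD0.
transitivity (wsum A (fun w => h [::] w +
    \sum_(0 <= k < size w) h (take k.+1 w) (drop k.+1 w))).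
  by apply: eq_wsum => w _; rewrite big_nat_recl // take0 drop0.
rewrite {1}/wsum big_split /=; congr (_ + _).
rewrite -[LHS]/(wsum A (fun w =>
  \sum_(0 <= k < size w) h (take k.+1 w) (drop k.+1 w))).
rewrite wsum_cons //.
transitivity (\sum_(b in A) \sum_(B : {set 'I_N} | B \subset A :\ b)
   wsum B (fun u => wsum ((A :\ b) :\: B) (h (b.+1 :: u)))).
  apply: eq_bigr => b bA; rewrite -(IHn _ (fun u => h (b.+1 :: u))) //.
  by apply/eqP; rewrite -eqSS -cA (cardsD1 b A) bA.
rewrite [RHS](eq_bigr (fun B : {set 'I_N} => \sum_(b in B)
   wsum (B :\ b) (fun u => wsum (A :\: B) (h (b.+1 :: u))))); last first.
  by move=> B /andP[_ B0]; rewrite wsum_cons.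
rewrite [RHS](exchange_big_dep (mem A)) /=; last first.
  by move=> B b /andP[/subsetP sBA _] /sBA.
apply: eq_bigr => b bA.
rewrite [RHS](reindex_onto (fun B : {set 'I_N} => b |: B)
                           (fun B : {set 'I_N} => B :\ b)) /=; last first.
  by move=> B /andP[_ bB]; rewrite setD1K.
apply: eq_big => B.
  rewrite subUset sub1set bA /= setU11 andbT subsetD1.
  rewrite (_ : b |: B != set0); last by apply/set0Pn; exists b; rewrite setU11.
  rewrite andbT; congr (_ && _); apply/idP/eqP => [/setU1K // | <-].
  by rewrite !inE eqxx.
rewrite subsetD1 => /andP[_ bB]; rewrite setU1K // -setDDl.
by [].
Qed.

Lemma sum_subsets A (phi : nat -> R) :
  \sum_(B : {set 'I_N} | B \subset A) phi #|B|
  = \sum_(k < #|A|.+1) 'C(#|A|, k)%:R * phi k.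
Proof.
rewrite (partition_big
  (fun B : {set 'I_N} => inord #|B| : 'I_#|A|.+1) predT) //=.
apply: eq_bigr => k _; rewrite -cards_draws.
rewrite (eq_bigr (fun _ => phi k)) => [|B /andP[sBA /eqP <-]]; last first.
  by rewrite inordK // ltnS subset_leq_card.
rewrite sumr_const mulr_natl; congr (_ *+ _); apply: eq_card => B.
rewrite [RHS]inE unfold_in /=; apply: andb_id2l => sBA.
by rewrite -val_eqE /= inordK // ltnS subset_leq_card.
Qed.

(** The rank in A is a bijection from A to the numbers below #|A|. *)
Lemma sum_rank A (phi : nat -> R) :
  \sum_(b in A) phi #|[set x in A | (x < b)%N]| = \sum_(j < #|A|) phi j.
Proof.
move: {2}#|A| (erefl #|A|) => n; elim: n A => [|n IHn] A cA.
  by rewrite (cards0_eq cA) cards0 big_ord0 big_set0.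
have [i0 i0A] : exists i, i \in A by apply/set0Pn; rewrite -card_gt0 cA.
have [b bA bmax] : exists2 b, b \in A & forall i, i \in A -> (i <= b)%N.
  by case: (arg_maxnP (fun i : 'I_N => i : nat) i0A) => b; exists b.
have cAb : #|A :\ b| = n by apply/eqP; rewrite -eqSS -cA (cardsD1 b A) bA.
rewrite cA big_ord_recr -cAb -IHn // (bigD1 b) //= addrC; congr (_ + _).
  rewrite [RHS](eq_bigl (fun i => (i \in A) && (i != b))); last first.
    by move=> i; rewrite !inE andbC.
  apply: eq_bigr => i /andP[iA neib]; congr (phi _); apply: eq_card => x.
  rewrite !inE; case: eqVneq => [->|//] /=.
  by rewrite ltnNge bmax // andbF.
congr (phi _); apply: eq_card => x; rewrite !inE.
case xA: (x \in A); rewrite ?andbF //= andbT ltn_neqAle bmax //.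
by rewrite andbT.
Qed.

Lemma set_min A : A != set0 ->
  exists2 mu, mu \in A & forall i, i \in A -> (mu <= i)%N.
Proof.
case/set0Pn => i0 i0A.
by case: (arg_minnP (fun i : 'I_N => i : nat) i0A) => b; exists b.
Qed.

End WordSums.

(** * The sum of the linked words on a set *)

Lemma zigzag_cons2 m l h v :
  zigzag m.+2 [:: l, h & v]
  = [&& (l < h)%N, (l < nth 0%N v 0)%N, (nth 0%N v 1 < h)%N & zigzag m.+1 v].
Proof.
apply/zigzagP/and4P => [[sz h1 h2]|[lh lv vh /zigzagP[sz h1 h2]]].
  have [lv vh] := h2 0%N isT; split; [exact: (h1 0%N)|exact: lv|exact: vh|].
  apply/zigzagP; split=> [|i lti|i lti]; first by move: sz => /=; lia.
    exact: (h1 i.+1).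
  exact: (h2 i.+1).
split=> [|[|i] lti|[|i] lti] //=.
  exact: (h1 i).
exact: (h2 i).
Qed.

Lemma zigzag_head_min m w : zigzag m.+1 w ->
  (forall x : nat, x \in drop m.*2.+1 w -> head 0%N (drop m.*2.+1 w) <= x)%N ->
  (forall x : nat, x \in w -> head 0%N w <= x)%N.
Proof.
move=> zw min x /(nthP 0%N)[i lti <-]; rewrite -!nth0 in min *.
have le0 : (nth 0 w 0 < nth 0 w m.*2.+1)%N.
  exact: (@zigzag_low_high _ w 0 m zw).
have [le|lt] := leqP m.*2.+1 i.
  have inD : nth 0%N w i \in drop m.*2.+1 w.
    by rewrite -(subnKC le) -nth_drop mem_nth // size_drop; lia.
  have := min _ inD; rewrite nth_drop addn0; apply: leq_trans; apply: ltnW le0.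
case: (posnP i) => [->//|ipos]; apply: ltnW.
rewrite (zigzag_ltn zw) /zigzag_rank //=; last by rewrite doubleS; lia.
by have := odd_double_half i; case: (odd i) => /=; lia.
Qed.

Section LinkSum.
Variables (R : comNzRingType) (a : nat) (y : R).
Hypothesis a0 : (0 < a)%N.
Local Notation link := (link a y).
Local Notation link_coef := (link_coef a y).

(** The first link begins with its least letter and ends with the first letter
    of the remaining linked word, which is the least one of that word. *)
Lemma link_head_min w : link w != 0 ->
  forall x : nat, x \in w -> (head 0%N w <= x)%N.
Proof.
move: {2}(size w) (leqnn (size w)) => n; elim: n w => [|n IHn] w lew.
  by case: w lew.
have [le1|gt1] := leqP (size w) 1.
  by case: w le1 {lew} => [|z [|]] // _ _ x; rewrite inE => /eqP->.
rewrite linkE // => nz; suff: [exists m : 'I_(size w),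
   zigzag m.+1 w && (link (drop m.*2.+1 w) != 0)].
  case/existsP=> m /andP[zw nzm]; apply: (zigzag_head_min zw); apply: IHn nzm.
  by rewrite size_drop; lia.
apply: contraNT nz; rewrite negb_exists => /forallP nz.
rewrite big1 // => m _; have := nz m; rewrite negb_and negbK.
by case: (zigzag _ _) => /= [/eqP->|_]; rewrite ?mulr0 ?mul0r.
Qed.

Lemma zigzag_link_head_min m w : zigzag m.+1 w -> link (drop m.*2.+1 w) != 0 ->
  forall x : nat, x \in w -> (head 0%N w <= x)%N.
Proof. by move=> zw nz; apply: (zigzag_head_min zw); apply: link_head_min. Qed.

(** The number of ways to choose m highs of a zigzag with m + 1 pairs among r
    letters, when the m + 1 lows and the last high are the m + 2 least
    letters. *)
Definition zigzag_coef (r m : nat) : nat := 'C(r - m.+2, m) * (m.+1.*2 <= r).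

(** The hockey-stick identity for the choice of the first high. *)
Lemma sum_zigzag_coef m s :
  (\sum_(j < s) zigzag_coef j m = zigzag_coef s.+1 m.+1)%N.
Proof.
elim: s => [|s IHs]; first by rewrite big_ord0 /zigzag_coef leqNgt /= muln0.
rewrite big_ord_recr /= {}IHs /zigzag_coef !subSS !doubleS !ltnS.
have [lt|le] := ltnP m.*2.+1 s; last by rewrite ltnNge leqW ?muln0.
have -> : (s - m.+1 = (s - m.+2).+1)%N by lia.
rewrite binS !muln1.
case: (ltngtP m.*2.+2 s) lt => // [lt _|<- _]; first by rewrite muln1.
have -> : (m.*2.+2 - m.+2 = m)%N by lia.
by rewrite bin_small.
Qed.

Variables (N : nat) (U : nat -> R).
Implicit Types (A B : {set 'I_N}).

(** The first letter must be the least letter of A. *)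
Lemma wsum_zigzag_min A mu m (c : seq nat -> bool) : mu \in A ->
  (forall i, i \in A -> (mu <= i)%N) ->
  wsum A (fun w => (zigzag m.+1 w && c w)%:R * link (drop m.*2.+1 w))
  = wsum (A :\ mu) (fun w => (zigzag m.+1 (mu.+1 :: w) && c (mu.+1 :: w))%:R
       * link (drop m.*2 w)).
Proof.
move=> muA mumin; rewrite wsum_cons; last by apply/set0Pn; exists mu.
rewrite (bigD1 mu) //= [X in _ + X]big1 ?addr0 // => b /andP[bA neb].
apply: wsum_eq0 => w pw; case: andP => [[zw _]|_]; last by rewrite mul0r.
rewrite mul1r; have [//|nz] := eqVneq (link (drop m.*2 w)) 0.
have : (b < mu.+1)%N.
  apply: (zigzag_link_head_min zw nz (x := mu.+1)).
  by rewrite inE (mem_word pw) !inE [mu == b]eq_sym neb muA orbT.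
by rewrite ltnS leq_eqVlt val_eqE (negPf neb) ltnNge mumin.
Qed.

(** The sum over the words on A that begin with a link of m + 1 pairs.  The
    bound h on the first high lets the induction on m remove the first pair: the
    low is the least letter of A, the high is any letter b < h, and b is the
    bound for the high that follows. *)
Lemma wsum_zigzag n m A h :
  (forall B, 0 < #|B| < n -> wsum B link = - U #|B|)%N ->
  (#|A| <= n)%N ->
  wsum A (fun w => (zigzag m.+1 w && (nth 0%N w 1 < h)%N)%:R
                   * link (drop m.*2.+1 w))
  = - ((zigzag_coef #|[set x in A | (x.+1 < h)%N]| m)%:R
       * U (#|A| - m.*2.+1)%N).
Proof.
move=> IHn; elim: m A h => [|m IHm] A h leA.
  have [->|A0] := eqVneq A set0.
    rewrite wsum_set0 mul0r /zigzag_coef (_ : [set _ in _ | _] = set0).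
      by rewrite cards0 muln0 mul0r oppr0.
    by apply/setP=> x; rewrite !inE.
  have [mu muA mumin] := set_min A0; rewrite (wsum_zigzag_min _ _ muA) //.
  have cA := cardsD1 mu A; rewrite muA in cA.
  have [A1|A1] := eqVneq (A :\ mu) set0.
    rewrite A1 wsum_set0 /= mul0r /zigzag_coef leqNgt.
    rewrite (leq_ltn_trans (n := 1%N)) //; first by rewrite muln0 mul0r oppr0.
    apply: leq_trans (subset_leq_card _) (_ : #|A| <= 1)%N.
      by apply/subsetP=> x; rewrite inE => /andP[].
    by rewrite cA A1 cards0.
  have [nu nuA numin] := set_min A1.
  (* The rest is a linked word, so the high is its least letter nu. *)
  transitivity (wsum (A :\ mu) (fun w => (nu.+1 < h)%N%:R * link w)).
    apply: eq_wsum => w pw; rewrite drop0.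
    have [->|nz] := eqVneq (link w) 0; first by rewrite !mulr0.
    congr (_%:R * _); have nuw : nu.+1 \in w by rewrite (mem_word pw).
    have hw : head 0%N w \in w.
      by case: w nuw {pw nz} => //= *; rewrite mem_head.
    have [i iA hi] := wordP pw hw.
    have -> : w = nu.+1 :: behead w.
      have := link_head_min nz nuw; rewrite hi ltnS => le.
      have -> : nu.+1 = head 0%N w.
        by rewrite hi; congr _.+1; apply/eqP; rewrite eqn_leq le numin.
      by case: w hw {pw nz nuw hi}.
    rewrite zigzag1 /= ltnS ltn_neqAle mumin; last by case/setD1P: nuA.
    by case/setD1P: nuA; rewrite eq_sym val_eqE => ->.
  rewrite wsum_scale IHn; last by rewrite card_gt0 A1; lia.
  rewrite /zigzag_coef bin0 mul1n subn1 cA /= mulrN; congr (- (_%:R * _)).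
  congr (nat_of_bool _); apply/idP/idP => [lt|].
    apply: (@leq_trans #|[set mu; nu]|).
      by rewrite cards2; case/setD1P: nuA; rewrite eq_sym => ->.
    apply: subset_leq_card; apply/subsetP=> x; rewrite !inE => /orP[] /eqP->.
      rewrite muA (leq_trans _ lt) // !ltnS mumin //.
      by case/setD1P: nuA.
    by rewrite lt; case/setD1P: nuA => _ ->.
  apply: contraLR; rewrite -!leqNgt => leh; rewrite -[1%N](cards1 mu).
  apply: subset_leq_card; apply/subsetP=> x; rewrite !inE => /andP[xA ltx].
  apply/negPn/negP => nex; have := numin x.
  by rewrite !inE nex xA => /(_ isT); rewrite leqNgt -ltnS (leq_trans ltx leh).
have [->|A0] := eqVneq A set0.
  rewrite wsum_set0 mul0r /zigzag_coef (_ : [set _ in _ | _] = set0).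
    by rewrite cards0 muln0 mul0r oppr0.
  by apply/setP=> x; rewrite !inE.
have [mu muA mumin] := set_min A0; rewrite (wsum_zigzag_min _ _ muA) //.
have cA := cardsD1 mu A; rewrite muA in cA.
set A1 := A :\ mu in cA *; pose A2 := [set x in A1 | (x.+1 < h)%N].
(* One letter fewer is below h after mu is removed, unless none is below h. *)
have coefE : zigzag_coef #|[set x in A | (x.+1 < h)%N]| m.+1
             = (\sum_(j < #|A2|) zigzag_coef j m)%N.
  rewrite sum_zigzag_coef; have [lt|le] := ltnP mu.+1 h.
    congr (zigzag_coef _ _); rewrite (cardsD1 mu) inE muA lt add1n; congr _.+1.
    by apply: eq_card => x; rewrite !inE andbA.
  rewrite (_ : [set x in A | _] = set0); last first.
    apply/setP=> x; rewrite !inE; case xA: (x \in A) => //=.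
    by apply/negbTE; rewrite -leqNgt (leq_trans le) // ltnS mumin.
  rewrite (_ : A2 = set0); last first.
    apply/setP=> x; rewrite !inE; case xA: (x \in A) => //=; rewrite ?andbF //.
    apply/negbTE; rewrite negb_and -leqNgt (leq_trans le) ?orbT //.
    by rewrite ltnS mumin.
  by rewrite cards0 /zigzag_coef !muln0.
have [A10|A1n] := eqVneq A1 set0.
  rewrite coefE (_ : A2 = set0) ?A10 ?wsum_set0 ?cards0 ?big_ord0.
    by rewrite /zigzag /= !mul0r oppr0.
  by rewrite /A2 A10; apply/setP=> x; rewrite !inE.
rewrite wsum_cons //.
transitivity (\sum_(b in A2) - ((zigzag_coef #|[set x in A2 | (x < b)%N]| m)%:R
                    * U (#|A| - m.+1.*2.+1)%N)).
  rewrite [RHS](eq_bigl (fun b => (b \in A1) && (b.+1 < h)%N)); last first.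
    by move=> b; rewrite inE.
  rewrite [RHS]big_mkcondr; apply: eq_bigr => b bA.
  have [mub ltmub] : b \in A /\ (mu < b)%N.
    case/setD1P: bA => neb bA; split=> //.
    by rewrite ltn_neqAle mumin // andbT eq_sym val_eqE.
  transitivity (wsum (A1 :\ b) (fun v => (b.+1 < h)%N%:R *
     ((zigzag m.+1 v && (nth 0 v 1 < b.+1)%N)%:R * link (drop m.*2.+1 v)))).
    apply: eq_wsum => v pv; rewrite mulrA -natrM mulnb /=; congr (_%:R * _).
    rewrite zigzag_cons2 ltnS ltmub /=.
    case zv: (zigzag m.+1 v); rewrite ?andbF //= andbT andbC; congr (_ && _).
    have szv : (0 < size v)%N by have := zigzag_size zv; lia.
    have [i] := wordP pv (mem_nth 0%N szv).
    rewrite !inE => /and3P[_ nei iA] ->.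
    by rewrite ltnS ltn_neqAle mumin // eq_sym val_eqE nei.
  have cA1 := cardsD1 b A1; rewrite bA in cA1.
  rewrite wsum_scale; case: ifP => lt; last by rewrite mul0r.
  rewrite mul1r IHm; last by move: leA; rewrite cA cA1; lia.
  congr (- (_%:R * U _)); last by rewrite cA cA1 doubleS.
  congr (zigzag_coef _ _); apply: eq_card => x; rewrite !inE ltnS.
  case: (eqVneq x b) => [->|_] /=; first by rewrite ltnn andbF.
  case: (ltnP x b) => [ltx|_]; last by rewrite !andbF.
  by rewrite !andbT (leq_ltn_trans _ lt) ?andbT // ltnS ltnW.
rewrite sumrN -mulr_suml; congr (- (_ * _)).
by rewrite (sum_rank A2 (fun j => (zigzag_coef j m)%:R : R)) -natr_sum coefE.
Qed.

Hypothesis U1 : U 1%N = - y.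
Hypothesis UE : forall n, (1 < n)%N ->
  U n = \sum_(m < n) link_coef m * ((zigzag_coef n m)%:R * U (n - m.*2.+1)%N).

Lemma wsum_link A : A != set0 -> wsum A link = - U #|A|.
Proof.
move: {2}#|A| (leqnn #|A|) => n; elim: n A => [|n IHn] A leA.
  by rewrite -card_gt0; lia.
move=> A0; have [A1|gt1] := leqP #|A| 1.
  have /cards1P[b ->] : #|A| == 1%N by rewrite eqn_leq A1 card_gt0.
  rewrite wsum_cons; last by rewrite -card_gt0 cards1.
  rewrite big_set1 (_ : _ :\ _ = set0) ?wsum_set0 ?cards1 ?U1 ?opprK //.
  by apply/setP=> x; rewrite !inE; case: eqP.
rewrite UE // -sumrN.
(* All letters are at most N, so the bound h = N + 1 is no restriction. *)
transitivity (wsum A (fun w => \sum_(m < #|A|) link_coef m *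
   ((zigzag m.+1 w && (nth 0%N w 1 < N.+1)%N)%:R * link (drop m.*2.+1 w)))).
  apply: eq_wsum => w pw; have szw := size_word pw.
  rewrite linkE ?szw //; apply: eq_bigr => m _; rewrite mulrA.
  have lt1 : (1 < size w)%N by rewrite szw.
  have [i _ ->] := wordP pw (mem_nth 0%N lt1).
  by rewrite ltnS ltn_ord andbT.
rewrite wsum_sum; apply: eq_bigr => m _; rewrite wsum_scale -mulrN.
rewrite (@wsum_zigzag #|A|) // => [|B /andP[B0 ltB]]; last first.
  by apply: IHn; rewrite -?card_gt0 //; lia.
congr (_ * - (_%:R * _)); congr (zigzag_coef _ _); apply: eq_card => x.
by rewrite !inE ltnS ltn_ord andbT.
Qed.

End LinkSum.

(** * Cutting a word at its least letter *)

Definition lrmin (w : seq nat) : nat :=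
  count (fun j => all (fun z => nth 0%N w j < z)%N (take j w))
        (iota 0 (size w)).

Lemma lrmin_min u mu v :
  all (ltn mu) u -> all (ltn mu) v -> lrmin (u ++ mu :: v) = (lrmin u).+1.
Proof.
move=> mu_u mu_v; rewrite /lrmin size_cat iotaD count_cat add0n /=.
rewrite take_size_cat // nth_cat ltnn subnn /= mu_u addnA addn1.
rewrite [X in (_ + X)%N](_ : _ = 0%N) ?addn0.
  congr _.+1; apply: eq_in_count => j; rewrite mem_iota add0n => /= ltj.
  by rewrite nth_cat ltj takel_cat // ltnW.
apply/eqP; rewrite -leqn0 leqNgt -has_count; apply/hasPn => j.
rewrite mem_iota => /andP[lej ltj]; apply/allPn; exists mu.
  rewrite take_cat ltnNge (ltnW lej) /= -(subnSK lej) /=.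
  by rewrite mem_cat mem_head orbT.
rewrite -leqNgt nth_cat ltnNge (ltnW lej) /= -(subnSK lej) /=.
apply/ltnW/(allP mu_v)/mem_nth.
by rewrite -(ltn_add2l (size u).+1) subnKC.
Qed.

(** A match that begins in u and contains mu would have mu below its first
    letter, which is the least letter of a zigzag. *)
Lemma avoids_min a u mu v : (0 < a)%N -> all (ltn mu) u ->
  avoids a (u ++ mu :: v) = avoids a u && avoids a (mu :: v).
Proof.
move=> a0; elim: u => //= x u IHu /andP[mux muu].
rewrite IHu //= -!andbA; congr (~~ _ && _).
have [le|lt] := leqP a.*2 (size u).+1.
  by rewrite -(zigzag_take (k := (size u).+1) _ le) /= take_size_cat.
transitivity false; last by apply/esym/negbTE/negP => /zigzag_size /=; lia.
apply/negP => zw; have /= := zigzag_ltn zw (_ : 0 < _)%N lt.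
rewrite nth_cat ltnn subnn /= => e; have : (x < mu)%N; last by lia.
rewrite e /zigzag_rank /=; last by lia.
have := odd_double_half (size u).+1; rewrite /=.
by case: (odd (size u)) => /=; lia.
Qed.

Lemma wdes_min u mu v : all (ltn mu) u ->
  ((0 < size (u ++ mu :: v))%N + wdes (u ++ mu :: v)
   = (0 < size u)%N + wdes u + (1 + wdes (mu :: v)))%N.
Proof.
elim: u => //= x u IHu /andP[mux muu]; have := IHu muu.
case: u {IHu} muu => [_|z u /=]; last by lia.
by rewrite /= [(x < mu)%N]ltnNge (ltnW mux) /=; lia.
Qed.

Section LeftToRightMinima.
Variables (R : comNzRingType) (a : nat) (y : R).
Hypothesis a0 : (0 < a)%N.
Local Notation link := (link a y).
Local Notation weight := (weight a y).

Definition lr_weight (x : R) (w : seq nat) : R := x ^+ lrmin w * weight w.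

Lemma lr_weight1 w : lr_weight 1 w = weight w.
Proof. by rewrite /lr_weight expr1n mul1r. Qed.

Lemma lr_weight0 x : lr_weight x [::] = 1.
Proof. by rewrite /lr_weight weight0 mulr1. Qed.

Lemma lr_weight_min x u mu v : all (ltn mu) u -> all (ltn mu) v ->
  lr_weight x (u ++ mu :: v) = lr_weight x u * (x * weight (mu :: v)).
Proof.
move=> muu muv; rewrite /lr_weight lrmin_min //.
rewrite /weight wdes_min // avoids_min //.
by rewrite exprS !exprD -mulnb natrM; ring.
Qed.

Variable N : nat.
Implicit Types (A B : {set 'I_N}).

(** For the least letter mu of A, these are the words whose only left-to-right
    minimum is the first letter: the coefficients of B in N' = x N B. *)
Definition min_sum (mu : 'I_N) A : R :=
  wsum A (fun v => (head 0%N v == mu.+1)%:R * weight v).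

(** The equation N' = x N B.  The letters before mu can be any set of letters
    other than mu. *)
Lemma wsum_lr_weight x A mu : mu \in A -> (forall i, i \in A -> (mu <= i)%N) ->
  wsum A (lr_weight x) =
  \sum_(B : {set 'I_N} | B \subset A :\ mu)
     wsum B (lr_weight x) * (x * min_sum mu (A :\: B)).
Proof.
move=> muA mumin.
pose h u v := lr_weight x u * (x * ((head 0%N v == mu.+1)%:R * weight v)).
transitivity (wsum A (fun w =>
    \sum_(0 <= k < (size w).+1) h (take k w) (drop k w))).
  (* Only the cut at the position of mu contributes. *)
  apply: eq_wsum => w pw; have muw : mu.+1 \in w by rewrite (mem_word pw).
  have uw : uniq w.
    by rewrite (perm_uniq pw) map_inj_uniq ?enum_uniq // => i j [/val_inj].
  have ltk : (index mu.+1 w < size w)%N by rewrite index_mem.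
  rewrite (bigD1_seq (index mu.+1 w)) ?iota_uniq ?mem_index_iota //=; last lia.
  have dw : drop (index mu.+1 w) w = mu.+1 :: drop (index mu.+1 w).+1 w.
    by rewrite (drop_nth 0%N ltk) nth_index.
  rewrite big_nat_cond big1 => [|k /andP[/andP[_ lek] nek]].
    rewrite addr0 /h !dw /= eqxx mul1r -lr_weight_min -?dw ?cat_take_drop //.
      apply/allP=> z zw; have [i iA zE] := wordP pw (mem_take zw).
      rewrite zE /= ltnS ltn_neqAle mumin // andbT; apply: contraTneq zw => e.
      by rewrite zE -e in_take_leq ?ltnn // ltnW.
    apply/allP=> z zw; have [i iA zE] := wordP pw (mem_drop zw).
    rewrite zE /= ltnS ltn_neqAle mumin // andbT; apply: contraTneq zw => e.
    by have := drop_uniq (index mu.+1 w) uw; rewrite dw zE -e /= => /andP[].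
  rewrite /h -nth0 nth_drop addn0.
  case: eqP => [e|_]; last by rewrite mul0r !mulr0.
  have [ltkw|] := ltnP k (size w); last by move=> ge; rewrite nth_default in e.
  by rewrite -e index_uniq // eqxx in nek.
rewrite wsum_cut.
rewrite [RHS](eq_bigl
    (fun B : {set 'I_N} => (B \subset A) && (mu \notin B))); last first.
  by move=> B; rewrite subsetD1.
rewrite [RHS]big_mkcondr; apply: eq_bigr => B sBA; rewrite /h.
transitivity (wsum B (lr_weight x) * (x * min_sum mu (A :\: B))).
  rewrite mulrC -wsum_scale; apply: eq_wsum => u _.
  by rewrite !wsum_scale mulrC.
case: ifPn; rewrite ?negbK // => muB.
rewrite /min_sum [wsum (A :\: B) _]wsum_eq0 ?mulr0 // => v pv.
have [v0|v0] := posnP (size v); first by rewrite (size0nil v0) mul0r.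
have [i iA] := wordP pv (mem_nth 0%N v0); rewrite -nth0 => ->.
case: eqP => [[/val_inj e]|_]; last by rewrite mul0r.
by move: iA; rewrite e inE muB.
Qed.

(** With P = 1 / U, the sequences p, b and q are the numerators n! F_n of the
    series P, (log P)' and P^x.  The hypotheses are the equations U P = 1,
    P' = P (log P)' and (P^x)' = x P^x (log P)', compared below with the
    equations satisfied by the sums over words. *)
Section Sequences.
Variables (x : R) (U p b q : nat -> R).
Hypotheses (U0 : U 0%N = 1) (p0 : p 0%N = 1) (q0 : q 0%N = 1).
Hypothesis wlink : forall A, A != set0 -> wsum A link = - U #|A|.
Hypothesis Up : forall n, (0 < n)%N ->
  \sum_(k < n.+1) 'C(n, k)%:R * U k * p (n - k)%N = 0.
Hypothesis pb : forall n,
  p n.+1 = \sum_(k < n.+1) 'C(n, k)%:R * p k * b (n - k)%N.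
Hypothesis qb : forall n,
  q n.+1 = x * \sum_(k < n.+1) 'C(n, k)%:R * q k * b (n - k)%N.

Lemma wsum_weight A : wsum A weight = p #|A|.
Proof.
move: {2}#|A| (leqnn #|A|) => n; elim: n A => [|n IHn] A leA.
  have -> : A = set0 by apply: cards0_eq; lia.
  by rewrite wsum_set0 cards0 weight0.
have [->|A0] := eqVneq A set0; first by rewrite wsum_set0 cards0 weight0.
have cA : (0 < #|A|)%N by rewrite card_gt0.
rewrite (eq_wsum (g := fun w =>
   \sum_(0 <= k < (size w).+1) link (take k w) * weight (drop k w)));
  last first.
  by move=> w /size_word szw; apply: weight_link; rewrite ?szw.
rewrite (wsum_cut A (fun u v => link u * weight v)).
pose phi k : R := if k == 0%N then 0 else - (U k * p (#|A| - k)%N).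
transitivity (\sum_(B : {set 'I_N} | B \subset A) phi #|B|).
  apply: eq_bigr => B sBA.
  rewrite (eq_wsum (g := fun u => wsum (A :\: B) weight * link u)); last first.
    by move=> u _; rewrite wsum_scale mulrC.
  rewrite wsum_scale /phi cards_eq0; case: eqVneq => [->|B0].
    by rewrite wsum_set0 mulr0.
  have cB : (0 < #|B|)%N by rewrite card_gt0.
  by rewrite wlink // IHn ?cardsDS //; [rewrite mulrN mulrC|lia].
rewrite sum_subsets; have := Up cA; rewrite !big_ord_recl /phi /= mulr0 add0r.
rewrite bin0 mul1r U0 mul1r subn0 => /eqP; rewrite addr_eq0 => /eqP->.
by rewrite -sumrN; apply: eq_bigr => k _; rewrite mulrN mulrA.
Qed.

(** At x = 1, [wsum_lr_weight] is the equation P' = P B, in which the empty set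
    contributes the sum for A itself and the other sets contribute sums over
    smaller sets. *)
Lemma min_sumE A mu : mu \in A -> (forall i, i \in A -> (mu <= i)%N) ->
  min_sum mu A = b #|A|.-1.
Proof.
move: {2}#|A| (leqnn #|A|) => n; elim: n A => [|n IHn] A leA muA mumin.
  by move: leA; rewrite (cardsD1 mu) muA.
have cA := cardsD1 mu A; rewrite muA add1n in cA.
have /= := wsum_lr_weight 1 muA mumin.
rewrite (eq_wsum (g := weight)); last by move=> w _; rewrite lr_weight1.
rewrite wsum_weight cA pb (bigD1 set0) ?sub0set //=.
rewrite wsum_set0 lr_weight0 !mul1r setD0.
pose phi k : R := if k == 0%N then 0 else p k * b (#|A :\ mu| - k)%N.
rewrite (eq_bigr (fun B : {set 'I_N} => phi #|B|)); last first.
  move=> B /andP[sB B0]; rewrite mul1r /phi cards_eq0 (negPf B0).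
  rewrite (eq_wsum (g := weight)); last by move=> w _; rewrite lr_weight1.
  have cB : (0 < #|B|)%N by rewrite card_gt0.
  have [sBA muB] : B \subset A /\ mu \notin B.
    by move: sB; rewrite subsetD1 => /andP[].
  rewrite wsum_weight IHn ?(cardsDS sBA) ?cA //.
  - by rewrite subSn /= ?subset_leq_card.
  - by rewrite -cA; lia.
  - by rewrite inE muB.
  by move=> i /setDP[/mumin].
rewrite big_ord_recl bin0 p0 !mul1r subn0.
have -> : \sum_(B : {set 'I_N} | (B \subset A :\ mu) && (B != set0)) phi #|B|
        = \sum_(B : {set 'I_N} | B \subset A :\ mu) phi #|B|.
  by rewrite [RHS](bigD1 set0) ?sub0set //= {2}/phi cards0 eqxx add0r.
rewrite sum_subsets big_ord_recl {1}/phi /= mulr0 add0r.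
rewrite (eq_bigr (fun k : 'I_#|A :\ mu| => 'C(#|A :\ mu|, k.+1)%:R * phi k.+1)).
  by move/addIr.
by move=> k _; rewrite /phi /= mulrA.
Qed.

Lemma wsum_lr_weightE A : wsum A (lr_weight x) = q #|A|.
Proof.
move: {2}#|A| (leqnn #|A|) => n; elim: n A => [|n IHn] A leA.
  have -> : A = set0 by apply: cards0_eq; lia.
  by rewrite wsum_set0 cards0 lr_weight0.
have [->|A0] := eqVneq A set0; first by rewrite wsum_set0 cards0 lr_weight0.
have [mu muA mumin] := set_min A0.
have cA := cardsD1 mu A; rewrite muA add1n in cA.
rewrite (wsum_lr_weight x muA mumin) cA qb mulr_sumr.
pose phi k := x * (q k * b (#|A :\ mu| - k)%N).
rewrite (eq_bigr (fun B : {set 'I_N} => phi #|B|)) => [|B].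
  by rewrite sum_subsets /phi; apply: eq_bigr => k _; ring.
rewrite subsetD1 => /andP[sBA muB].
have sB : B \subset A :\ mu by rewrite subsetD1 sBA.
have := subset_leq_card sB => leB.
rewrite IHn; last by lia.
rewrite min_sumE ?(cardsDS sBA) ?cA ?inE ?muB //;
  last by move=> i /setDP[/mumin].
by rewrite subSn //= mulrCA.
Qed.

End Sequences.
End LeftToRightMinima.

(** * Permutations as words *)

Section Reduction.
Local Open Scope nat_scope.
Implicit Types (v w t : seq nat) (n m a : nat).

Definition order_iso v t : Prop := size v = size t /\
  (forall p q, p < size v -> q < size v ->
     (nth 0 v p < nth 0 v q) = (nth 0 t p < nth 0 t q)).

Lemma size_red v : size (red v) = size v.
Proof. by rewrite size_map. Qed.

Lemma nth_red v p : p < size v ->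
  nth 0 (red v) p = (count (fun y => y < nth 0 v p) v).+1.
Proof. by move=> lt; rewrite (nth_map 0). Qed.

Lemma red_order_iso v : order_iso (red v) v.
Proof.
split=> [|p q]; rewrite ?size_red // => ltp ltq; rewrite !nth_red // ltnS.
have [lt|le] := ltnP (nth 0 v p) (nth 0 v q); last first.
  by apply/negbTE; rewrite -leqNgt; apply: sub_count => y /=; lia.
have cE : count (fun y => y < nth 0 v q) v = count (fun y => y < nth 0 v p) v
    + count (fun y => nth 0 v p <= y < nth 0 v q) v.
  by elim: (v in count _ v = count _ v + count _ v) => //= x u ->; lia.
rewrite cE -[X in X < _]addn0 ltn_add2l -has_count; apply/hasP.
by exists (nth 0 v p); [apply: mem_nth | rewrite leqnn].
Qed.

(** The reduction of a word depends only on its order type. *)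
Lemma order_iso_red v t : order_iso v t -> red v = red t.
Proof.
move=> [sz e]; apply: (@eq_from_nth _ 0) => [|p]; rewrite size_red ?size_red //.
move=> ltp; rewrite !nth_red -?sz //; congr _.+1.
have cE u : count (fun y => y < nth 0 u p) u
    = count (fun q => nth 0 u q < nth 0 u p) (iota 0 (size u)).
  by rewrite -{2}[u](mkseq_nth 0) /mkseq count_map.
rewrite !cE -sz; apply: eq_in_count => q; rewrite mem_iota => ltq.
by apply: e.
Qed.

Lemma zigzag_order_iso m v t : order_iso t v -> zigzag m t -> zigzag m v.
Proof.
move=> [sz e] /zigzagP[szt h1 h2]; apply/zigzagP; rewrite -sz; split=> // i lti.
  by rewrite -e ?h1 //; lia.
by have [lo hi] := h2 i lti; rewrite -!e ?lo ?hi //; lia.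
Qed.

Lemma zigzag_unique m v t : size v = m.*2 -> size t = m.*2 ->
  zigzag m v -> zigzag m t -> order_iso v t.
Proof.
move=> sv st zv zt; split=> [|p q]; rewrite ?st // sv => ltp ltq.
by rewrite (zigzag_ltn zv) // (zigzag_ltn zt).
Qed.

End Reduction.

Lemma count_ltn_iota k n : (k <= n)%N ->
  count (fun j => j < k)%N (iota 0 n) = k.
Proof.
move=> lekn; rewrite -(subnKC lekn) iotaD count_cat.
rewrite (eq_in_count (a2 := predT)); last first.
  by move=> j; rewrite mem_iota => /= ->.
rewrite count_predT size_iota.
rewrite (eq_in_count (a2 := pred0)) ?count_pred0 ?addn0 //.
by move=> j; rewrite mem_iota add0n => /andP[lekj _]; rewrite ltnNge lekj.
Qed.

Section Oneline.
Variable n : nat.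
Implicit Type s : 'S_n.

Lemma size_oneline s : size (oneline s) = n.
Proof. by rewrite size_map size_enum_ord. Qed.

Lemma nth_oneline s (i : 'I_n) : nth 0%N (oneline s) i = (s i).+1.
Proof. by rewrite (nth_map i) ?size_enum_ord // nth_ord_enum. Qed.

Lemma oneline_letters s : oneline s = letters [seq s i | i <- enum 'I_n].
Proof. by rewrite /letters -map_comp. Qed.

Lemma perm_oneline s : perm_eq [seq s i | i <- enum 'I_n] (enum 'I_n).
Proof.
apply: uniq_perm; rewrite ?enum_uniq //.
  by rewrite map_inj_uniq ?enum_uniq //; apply: perm_inj.
move=> i; rewrite mem_enum inE; apply/mapP; exists (s^-1%g i).
  by rewrite mem_enum.
by rewrite permKV.
Qed.

Lemma red_oneline s : red (oneline s) = oneline s.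
Proof.
rewrite -[RHS]map_id; apply/eq_in_map => x /mapP[i _ ->]; congr _.+1.
rewrite oneline_letters count_map.
rewrite (seq.permP (perm_oneline s)).
transitivity (count (fun j => j < s i)%N (map val (enum 'I_n))).
  by rewrite count_map; apply: eq_count.
by rewrite val_enum_ord count_ltn_iota // ltnW.
Qed.

(** The one-line notations are the words on the full alphabet: they are distinct
    words, and there are n! of both. *)
Lemma sum_perm (R : comNzRingType) (f : seq nat -> R) :
  \sum_(s : 'S_n) f (oneline s) = wsum [set: 'I_n] f.
Proof.
pose r := [seq [seq s i | i <- enum 'I_n] | s : 'S_n].
have pE : perm_eq (enum [set: 'I_n]) (enum 'I_n).
  by apply: uniq_perm; rewrite ?enum_uniq // => i; rewrite !mem_enum inE.
have ur : uniq r.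
  rewrite map_inj_uniq ?enum_uniq // => s t /eq_in_map e.
  by apply/permP => i; apply: e; rewrite mem_enum.
have sr : {subset r <= permutations (enum 'I_n)}.
  by move=> w /mapP[s _ ->]; rewrite mem_permutations perm_oneline.
have szr : (size (permutations (enum 'I_n)) <= size r)%N.
  by rewrite size_permutations ?enum_uniq // size_enum_ord size_image card_Sn.
rewrite /wsum (perm_big _ (perm_permutations pE)).
rewrite (perm_big r) /=; last first.
  rewrite perm_sym; apply: uniq_perm; rewrite ?permutations_uniq //.
  by have [] := uniq_min_size ur sr szr.
by rewrite big_map big_enum; apply: eq_bigr => s _; rewrite oneline_letters.
Qed.

Lemma wdesE (w : seq nat) : wdes w =
  (\sum_(i < size w) ((i.+1 < size w) && ~~ (nth 0 w i < nth 0 w i.+1)))%N.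
Proof.
elim: w => [|x w IHw]; first by rewrite big_ord0.
rewrite /= big_ord_recl /= IHw; congr addn.
by case: w {IHw}.
Qed.

Lemma des_oneline s : des s = wdes (oneline s).
Proof.
rewrite /des -sum1dep_card big_mkcond wdesE size_oneline; apply: eq_bigr => i _.
rewrite (_ : [exists j, _] = (i.+1 < n) &&
   ~~ (nth 0 (oneline s) i < nth 0 (oneline s) i.+1))%N;
  first by case: (_ && _).
apply/existsP/andP => [[j /andP[/eqP ji lt]]|[lt nlt]].
  by rewrite -ji ltn_ord -leqNgt !nth_oneline ltnS ltnW.
exists (Ordinal lt); rewrite eqxx /=.
move: nlt; rewrite -leqNgt (nth_oneline s (Ordinal lt)) nth_oneline ltnS.
rewrite leq_eqVlt => /orP[/eqP/val_inj/perm_inj/(congr1 val) /= |//].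
by lia.
Qed.

Lemma LRmin_oneline s : LRmin s = lrmin (oneline s).
Proof.
rewrite /LRmin -sum1dep_card /lrmin size_oneline -val_enum_ord.
rewrite -sum1_count big_map big_enum_cond; apply: eq_bigl => j /=.
apply/forallP/(all_nthP 0%N) => h i.
  rewrite size_takel ?size_oneline ?(ltnW (ltn_ord j)) // => ltij.
  have lti := ltn_trans ltij (ltn_ord j).
  rewrite nth_take // nth_oneline (nth_oneline s (Ordinal lti)) ltnS.
  by have := h (Ordinal lti); rewrite ltij.
apply/implyP => ltij; have := h i.
rewrite size_takel ?size_oneline ?(ltnW (ltn_ord j)) // => /(_ ltij).
by rewrite nth_take // !nth_oneline.
Qed.

End Oneline.

Section Match.
Variables (a : nat) (tau : 'S_(2 * a)).
Hypotheses (a0 : (0 < a)%N) (zt : zigzag a (oneline tau)).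

(** Being a zigzag is invariant under order isomorphism and determines the order
    type, so the words that reduce to tau are the zigzags with a pairs. *)
Lemma has_match_at_zigzag n (s : 'S_n) (i : 'I_n) :
  has_match_at tau s i = zigzag a (drop i (oneline s)).
Proof.
have szt : size (oneline tau) = a.*2 by rewrite size_oneline mul2n.
apply/existsP/idP => [[j /andP[ltij /eqP e]]|zs].
  have sz : size (slice (oneline s) i j) = a.*2 by rewrite -szt -e size_red.
  have le : (a.*2 <= (j - i).+1)%N by rewrite -sz /slice size_take_min geq_minl.
  rewrite -(zigzag_take _ le).
  apply: (@zigzag_order_iso _ _ (oneline tau)) => //.
  by rewrite -e; apply: red_order_iso.
have szs := zigzag_size zs; rewrite size_drop size_oneline in szs.
have ltj : (i + a.*2.-1 < n)%N by lia.
exists (Ordinal ltj); rewrite /= -{1}[i : nat]addn0 ltn_add2l.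
rewrite (_ : (0 < a.*2.-1)%N); last by lia.
rewrite /slice addKn prednK ?double_gt0 //= -(red_oneline tau).
apply/eqP/order_iso_red/(@zigzag_unique a); rewrite ?zigzag_take //.
by rewrite size_takel // size_drop size_oneline.
Qed.

Lemma mem_NMset n (s : 'S_n) : (s \in NMset tau n) = avoids a (oneline s).
Proof.
rewrite inE; apply/forallP/avoidsP; rewrite size_oneline => h i.
  by move=> lti; have := h (Ordinal lti); rewrite has_match_at_zigzag.
by rewrite has_match_at_zigzag h.
Qed.

Lemma NMpoly_wsum n :
  NMpoly tau n = wsum [set: 'I_n] (lr_weight a ('X%:P) 'X).
Proof.
rewrite /NMpoly; case: posnP => [n0|n0].
  rewrite (_ : [set: 'I_n] = set0) ?wsum_set0 ?lr_weight0 //.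
  by apply: cards0_eq; rewrite cardsT card_ord.
rewrite -sum_perm big_mkcond; apply: eq_bigr => s _.
rewrite mem_NMset /lr_weight /weight size_oneline n0.
rewrite -LRmin_oneline -des_oneline.
by case: avoids; rewrite ?mul1r ?mul0r ?mulr0 // rmorphXn.
Qed.

End Match.

Lemma zigzag_tau a (tau : 'S_(2 * a)) :
  (forall i : nat, (1 <= i <= a)%N ->
     letter tau (2 * i - 1) = i /\ letter tau (2 * i) = (2 * a + 1 - i)%N) ->
  zigzag a (oneline tau).
Proof.
move=> h.
have lo i : (i < a)%N -> nth 0%N (oneline tau) i.*2 = i.+1.
  move=> lti; have [] := h i.+1 lti; rewrite /letter.
  by rewrite (_ : (2 * i.+1 - 1).-1 = i.*2)%N //; lia.
have hi i : (i < a)%N -> nth 0%N (oneline tau) i.*2.+1 = (2 * a - i)%N.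
  move=> lti; have [_] := h i.+1 lti; rewrite /letter.
  by rewrite (_ : (2 * i.+1).-1 = i.*2.+1)%N ?addn1 ?subSS //; lia.
apply/zigzagP; split=> [|i lti|i lti]; first by rewrite size_oneline mul2n.
  by rewrite lo ?hi; lia.
rewrite -doubleS lo ?lo ?hi ?(hi i.+1); lia.
Qed.


(** * The recurrence *)

(** Restricts a sum to the positive multiples of a up to the bound M on the
    support of g. *)
Lemma sum_posmult (R : comNzRingType) a M B (g : nat -> R) : (0 < a)%N ->
  (forall j, (M < j)%N -> g j = 0) -> (M < B)%N ->
  \sum_(j < B) (posmult a j)%:R * g j
  = \sum_(0 <= k < M %/ a) g ((k + 1) * a)%N.
Proof.
move=> a0 g0 leMB.
have -> : \sum_(j < B) (posmult a j)%:R * g j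
        = \sum_(j < M.+1) (posmult a j)%:R * g j.
  rewrite [RHS](big_ord_widen B (fun j => (posmult a j)%:R * g j)) //.
  rewrite [RHS]big_mkcond; apply: eq_bigr => j _.
  by case: ltnP => // lt; rewrite g0 ?mulr0.
elim: M {g0 leMB} => [|M IHM]; first by rewrite big_ord1 div0n big_geq // mul0r.
rewrite big_ord_recr /= IHM divnS // /posmult /=.
case: (boolP (a %| M.+1)%N) => [dvd|_]; last by rewrite mul0r addr0.
rewrite add1n big_nat_recr //= mul1r addn1 -[in LHS](divnK dvd).
by rewrite divnS // dvd.
Qed.

(** Both sums of the recurrence in terms of the number m + 1 of pairs: the first
    one has the terms with a dividing m + 1, the second one those with a
    dividing m, and the term (1 - y) U_(n-1) is the one for a linked ascent. *)
Lemma U_link_coef a (U : nat -> {poly rat}) : (0 < a)%N -> U_recurrence a U ->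
  forall n, (1 < n)%N ->
  U n = \sum_(m < n) link_coef a 'X m
          * ((zigzag_coef n m)%:R * U (n - m.*2.+1)%N).
Proof.
move=> a0 [_ _ UE] n n1; rewrite UE //.
pose g m : {poly rat} := 'X^m * ((zigzag_coef n m)%:R * U (n - m.*2.+1)%N).
have g0 m : (n < m.+1.*2)%N -> g m = 0.
  by move=> lt; rewrite /g /zigzag_coef (leqNgt _ n) lt muln0 mul0r mulr0.
(* The first sum is indexed by the number j = m + 1 of pairs. *)
pose g' j := if j is j'.+1 then g j' else 0.
have n0 : (0 < n)%N by lia.
transitivity ((1 - 'X) * U (n - 1)%N
  - \sum_(j < n.+1) (posmult a j)%:R * g' j
  + \sum_(j < n) (posmult a j)%:R * g j); last first.
  rewrite big_ord_recl mulr0 add0r -addrA -sumrN -big_split /=.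
  rewrite [RHS](eq_bigr (fun m : 'I_n => (1 - 'X) * (m == 0%N :> nat)%:R * g m +
     (- ((posmult a m.+1)%:R * g m) + (posmult a m)%:R * g m))); last first.
    move=> m _; rewrite /link_coef /g; move: (_%:R * U _) => Z.
    by case: eqVneq => [->|_] /=; rewrite ?expr0 ?mulr1 ?mulr0; ring.
  rewrite [RHS]big_split /=; congr (_ + _).
  rewrite (bigD1 (Ordinal n0)) //= big1 => [|m ne].
    by rewrite addr0 mulr1 /g /zigzag_coef bin0 n1 !mul1r.
  rewrite (_ : (m == 0%N :> nat) = false) ?mulr0 ?mul0r //.
  by apply: contraNF ne => /eqP m0; apply/eqP/val_inj.
have bound k p : (k < p %/ (2 * a))%N -> (2 * ((k + 1) * a) <= p)%N.
  by rewrite leq_divRL ?muln_gt0 // addn1 mulnCA mulnA.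
congr (_ - _ + _).
  rewrite (@sum_posmult _ a n./2) //; try lia; last first.
    by case=> // j lt; apply: g0; lia.
  rewrite -divn2 -divnMA; apply: eq_big_nat => k /andP[_ /bound].
  rewrite -!mulnA; have : (0 < (k + 1) * a)%N by rewrite muln_gt0 addn1.
  case: ((k + 1) * a)%N => // j _ lej; rewrite /g.
  rewrite subSS subn0 [RHS]mulrCA mulrA; congr (_ %:R * _ * U _); last lia.
  rewrite /zigzag_coef; have -> : (j.+1.*2 <= n)%N by lia.
  by rewrite muln1; congr 'C(_, _); lia.
rewrite (@sum_posmult _ a (n - 2)./2) //; try lia; last first.
  by move=> j lt; apply: g0; lia.
rewrite -divn2 -divnMA; apply: eq_big_nat => k /andP[_ /bound].
rewrite -!mulnA; move: ((k + 1) * a)%N => j lej; rewrite /g.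
rewrite [RHS]mulrCA mulrA; congr (_ %:R * _ * U _); last lia.
rewrite /zigzag_coef; have -> : (j.+1.*2 <= n)%N by lia.
by rewrite muln1; congr 'C(_, _); lia.
Qed.


(** * The generating function *)

Theorem theorem4 (a : nat) (ha : (2 <= a)%N) (tau : 'S_(2 * a))
  (htau : forall i : nat, (1 <= i <= a)%N ->
     letter tau (2 * i - 1) = i /\ letter tau (2 * i) = (2 * a + 1 - i)%N)
  (U : nat -> {poly rat}) (hU : U_recurrence a U) :
  NM tau =1 fps_pow (fps_inv (egf (fun n => (U n)%:P))) 'X.
Proof.
have a0 : (0 < a)%N by apply: ltnW.
have natU k : (k.+1%:R : {poly {poly rat}}) \is a GRing.unit.
  rewrite (_ : k.+1%:R = (k.+1%:R : rat)%:P%:P); last by rewrite !rmorph_nat.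
  by do 2!apply: rmorph_unit; rewrite unitfE Num.Theory.pnatr_eq0.
have factU n : (n`!%:R : {poly {poly rat}}) \is a GRing.unit.
  by case: n`! (fact_gt0 n).
set Ui := fun n => (U n)%:P; set E := egf Ui; set F := fps_inv E.
have [U0 U1 _] := hU.
have E0 : E 0%N = 1 by rewrite /E /egf /Ui U0 fact0 invr1 mulr1.
have F0 : F 0%N = 1 by apply: fps_inv0.
have UiE n : Ui n = E n * n`!%:R by rewrite divrK.
have Dfact (H : nat -> {poly {poly rat}}) n :
    H n.+1 * (n.+1)`!%:R = fps_D H n * n`!%:R.
  by rewrite factS natrM mulrA [H _ * _]mulr_natr.
(* The factors n! turn products of series into binomial convolutions. *)
pose p n := F n * n`!%:R; pose b n := fps_D (fps_Log F) n * n`!%:R.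
pose q n := fps_pow F 'X n * n`!%:R.
have Up n : (0 < n)%N -> \sum_(k < n.+1) 'C(n, k)%:R * Ui k * p (n - k)%N = 0.
  move=> n0; transitivity (fps_mul E F n * n`!%:R).
    by rewrite fact_fps_mul; apply: eq_bigr => k _; rewrite UiE.
  by rewrite fps_mul_inv // /fps_one eqn0Ngt n0 mul0r.
have pb n : p n.+1 = \sum_(k < n.+1) 'C(n, k)%:R * p k * b (n - k)%N.
  by rewrite -fact_fps_mul fps_D_Log_mul // -Dfact.
have qb n : q n.+1 = 'X * \sum_(k < n.+1) 'C(n, k)%:R * q k * b (n - k)%N.
  by rewrite -fact_fps_mul /q Dfact mulrA; congr (_ * _); apply: fps_D_pow.
have Ui1 : Ui 1%N = - ('X)%:P by rewrite /Ui U1 rmorphN.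
have UiK n : (1 < n)%N -> Ui n =
    \sum_(m < n) link_coef a ('X)%:P m
                   * ((zigzag_coef n m)%:R * Ui (n - m.*2.+1)%N).
  move=> n1; rewrite /Ui (U_link_coef a0 hU n1) rmorph_sum.
  apply: eq_bigr => m _.
  by rewrite /link_coef !(rmorphM, rmorphB, rmorph_nat, rmorphXn, rmorph1).
move=> n; rewrite /NM /egf (NMpoly_wsum a0 (zigzag_tau htau)).
rewrite (@wsum_lr_weightE _ _ _ a0 n 'X Ui p b q) ?cardsT ?card_ord //.
- by rewrite mulrK.
- by rewrite /Ui U0.
- by rewrite /p F0 mulr1.
- by rewrite /q /fps_pow fps_Exp0 mulr1.
by move=> A; apply: wsum_link.
Qed.
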